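(* In the setting below, if $A$ is not identically zero on $G$, then $\overline d(\mathcal S(\widehat a))<\infty$.
   Context: Let $\alpha$ be a PV number of degree $d\ge2$ (real algebraic integer, all other Galois conjugates $\alpha_2,\dots,\alpha_d$ of modulus $<1$). Let $\mathbb T=\mathbb R/\mathbb Z$, $\mathbb T^{\mathbb Z}$ the group of maps $\mathbb Z\to\mathbb T$ with product topology, $\theta(y)(j)=y\alpha^j+\mathbb Z$, $\vartheta(s)(j)=\sum_{k=1}^d s_k\alpha_k^j+\mathbb Z$ for $s\in S=\{s\in\mathbb C^d:s_1\in\mathbb R,\ \alpha_j=\overline{\alpha_k}\Rightarrow s_j=\overline{s_k}\}$, and $G=\overline{\vartheta(S)}$; $\theta(\mathbb R)$ is dense in $G$. Let $a:\mathbb N\to\mathbb C$ and $\tau:\mathbb N\to\mathbb Z[\alpha,\alpha^{-1}]$ satisfy $\sum_k|a(k)|e^{\eta|\tau(k)|}<\infty$ for some $\eta>0$ (''exponential decay''). Fix finitely supported $\tau_k:\mathbb Z\to\mathbb Z$ with $\tau(k)=\sum_j\tau_k(j)\alpha^j$. Let $\widehat a(y)=|\alpha|^{-1}\sum_k a(k)e^{-2\pi i\tau(k)y}$ and $A(g)=|\alpha|^{-1}\sum_k a(k)\exp(-2\pi i\sum_j\tau_k(j)g(j))$, $g\in G$. $\mathcal S(f)$ denotes the zero set of $f$ counted with multiplicity, and for such a multiset $Z\subset\mathbb R$, $\overline d(Z)=\limsup_{L\to\infty}\frac{1}{2L}\#(Z\cap(-L,L))$ and $\underline d(Z)=\liminf_{L\to\infty}\frac{1}{2L}\#(Z\cap(-L,L))$.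 *)

(* Defs.v *)
From Stdlib Require Import Reals Lra Lia ZArith List QArith Qreals.
Open Scope R_scope.

Record Cx := mkC { Cre : R; Cim : R }.

Definition C0 : Cx := mkC 0 0.
Definition C1 : Cx := mkC 1 0.
Definition RtoC (x : R) : Cx := mkC x 0.
Definition Cadd (z w : Cx) : Cx := mkC (Cre z + Cre w) (Cim z + Cim w).
Definition Copp (z : Cx) : Cx := mkC (- Cre z) (- Cim z).
Definition Csub (z w : Cx) : Cx := Cadd z (Copp w).
Definition Cmul (z w : Cx) : Cx :=
  mkC (Cre z * Cre w - Cim z * Cim w) (Cre z * Cim w + Cim z * Cre w).
Definition Cconj (z : Cx) : Cx := mkC (Cre z) (- Cim z).
Definition Cscale (r : R) (z : Cx) : Cx := mkC (r * Cre z) (r * Cim z).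
Definition Cmod (z : Cx) : R := sqrt (Cre z ^ 2 + Cim z ^ 2).
Definition Cinv (z : Cx) : Cx :=
  mkC (Cre z / (Cre z ^ 2 + Cim z ^ 2)) (- Cim z / (Cre z ^ 2 + Cim z ^ 2)).
Definition Cexpi (t : R) : Cx := mkC (cos t) (sin t).

Fixpoint Cpow (z : Cx) (n : nat) : Cx :=
  match n with O => C1 | S m => Cmul z (Cpow z m) end.
Definition CpowZ (z : Cx) (j : Z) : Cx :=
  match j with
  | Z0 => C1
  | Zpos p => Cpow z (Pos.to_nat p)
  | Zneg p => Cinv (Cpow z (Pos.to_nat p))
  end.

Fixpoint Csum_n (f : nat -> Cx) (n : nat) : Cx :=
  match n with O => C0 | S m => Cadd (Csum_n f m) (f m) end.
Fixpoint Cprod_n (f : nat -> Cx) (n : nat) : Cx :=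
  match n with O => C1 | S m => Cmul (Cprod_n f m) (f m) end.

Definition Cseries_to (f : nat -> Cx) (l : Cx) : Prop :=
  infinite_sum (fun k => Cre (f k)) (Cre l) /\
  infinite_sum (fun k => Cim (f k)) (Cim l).

Fixpoint evalZ_R (p : list Z) (x : R) : R :=
  match p with nil => 0 | c :: q => IZR c + x * evalZ_R q x end.
Fixpoint evalQ_R (p : list Q) (x : R) : R :=
  match p with nil => 0 | c :: q => Q2R c + x * evalQ_R q x end.
Fixpoint evalZ_C (p : list Z) (z : Cx) : Cx :=
  match p with nil => C0 | c :: q => Cadd (RtoC (IZR c)) (Cmul z (evalZ_C q z)) end.

Definition monic_Z_deg (p : list Z) (d : nat) : Prop :=
  length p = S d /\ nth d p 0%Z = 1%Z.

Definition alg_degree (alpha : R) (d : nat) : Prop :=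
  (exists q : list Q, length q = S d /\ ~ (Q2R (nth d q 0%Q) = 0) /\ evalQ_R q alpha = 0) /\
  (forall q : list Q, (length q <= d)%nat -> evalQ_R q alpha = 0 ->
      forall c, In c q -> Q2R c = 0).

(** PV number of degree d, with (complex) Galois conjugates
    alpha_1 = conjs 0 = alpha, alpha_2 = conjs 1, ..., alpha_d = conjs (d-1):
    alpha is a real algebraic integer of degree d, its minimal polynomial P
    (monic, integer coefficients, degree d) factors as prod_k (X - conjs k),
    and all conjugates other than alpha have modulus < 1. *)
Definition PV_with_conjugates (alpha : R) (d : nat) (conjs : nat -> Cx) : Prop :=
  alg_degree alpha d /\
  (exists P : list Z, monic_Z_deg P d /\ evalZ_R P alpha = 0 /\
     forall z : Cx, evalZ_C P z = Cprod_n (fun k => Csub z (conjs k)) d) /\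
  conjs 0%nat = RtoC alpha /\
  (forall k, (1 <= k < d)%nat -> Cmod (conjs k) < 1).

(** s = (s_1,...,s_d) encoded as s 0, ..., s (d-1) *)
Definition in_S (d : nat) (conjs : nat -> Cx) (s : nat -> Cx) : Prop :=
  Cim (s 0%nat) = 0 /\
  (forall j k, (j < d)%nat -> (k < d)%nat ->
     conjs j = Cconj (conjs k) -> s j = Cconj (s k)).

(** representative of vartheta(s)(j) = sum_k s_k alpha_k^j  (mod 1);
    the sum is real for s in S, we take its real part *)
Definition vartheta (d : nat) (conjs : nat -> Cx) (s : nat -> Cx) (j : Z) : R :=
  Cre (Csum_n (fun k => Cmul (s k) (CpowZ (conjs k) j)) d).

(** distance in T = R/Z less than eps *)
Definition T_close (x y eps : R) : Prop :=
  exists n : Z, Rabs (x - y - IZR n) < eps.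

(** Elements of T^Z are represented by g : Z -> R (values taken mod 1).
    g is in G = closure of vartheta(S) in the product topology iff every
    basic neighbourhood of g (finitely many coordinates, radius eps)
    meets vartheta(S). *)
Definition in_G (d : nat) (conjs : nat -> Cx) (g : Z -> R) : Prop :=
  forall (F : list Z) (eps : R), eps > 0 ->
    exists s, in_S d conjs s /\
      forall j, In j F -> T_close (vartheta d conjs s j) (g j) eps.

Definition sumZ_sym (N : nat) (f : Z -> R) : R :=
  fold_right Rplus 0
    (map (fun n => f (Z.of_nat n - Z.of_nat N)%Z) (seq 0 (2 * N + 1))).

Fixpoint nth_deriv (f : R -> Cx) (n : nat) (g : R -> Cx) : Prop :=
  match n with
  | O => forall x, g x = f x
  | S m => exists h, nth_deriv f m h /\
      forall x, derivable_pt_lim (fun t => Cre (h t)) x (Cre (g x)) /\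
                derivable_pt_lim (fun t => Cim (h t)) x (Cim (g x))
  end.

Definition zero_mult_ge (f : R -> Cx) (y0 : R) (m : nat) : Prop :=
  forall n, (n < m)%nat -> exists g, nth_deriv f n g /\ g y0 = C0.

(** #(S(f) ∩ (-L,L)) (with multiplicity) <= B:
    any finite family of distinct points in (-L,L), each a zero of
    multiplicity >= m_i, has sum of m_i <= B. *)
Definition zero_count_le (f : R -> Cx) (L B : R) : Prop :=
  forall zs : list (R * nat),
    NoDup (map fst zs) ->
    (forall p, In p zs -> - L < fst p < L /\ zero_mult_ge f (fst p) (snd p)) ->
    INR (fold_right Nat.add 0%nat (map snd zs)) <= B.

(** upper density of S(f) is finite:
    limsup_{L->oo} #(S(f) ∩ (-L,L)) / (2L) < oo *)
Definition upper_density_finite (f : R -> Cx) : Prop :=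
  exists M L0 : R, forall L, L >= L0 -> zero_count_le f L (M * (2 * L)).

(* Main.v *)
(* The transform is f(y) = sum_k b_k exp(i w_k y) with exponentially decaying coefficients, so
   |f^(n)| <= M n! / rho^n on the whole line. Points of G satisfy modulo 1 the recurrence given
   by the minimal polynomial of alpha, so the character exp(-2 pi i sum_j tau_k(j) g(j)) depends
   only on the number tau(k); hence if A(g) <> 0, grouping equal frequencies shows that some
   Fourier coefficient of f is nonzero, and averaging f(x + nh) exp(-i lam (x + nh)) over n,
   uniformly in x, gives c, T > 0 such that every interval of length T contains a point where
   |f| >= c. If an interval of length rho/4 contained too many zeros, Hermite's interpolation
   error formula, applied to the real and imaginary parts of f and their derivatives, would make
   a long initial segment of the Taylor coefficients tiny there; re-expanding in steps of rho/4
   propagates this across an interval of length T, a contradiction. So zeros are uniformly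
   bounded in number on intervals of length rho/4. *)

From Coquelicot Require Import Coquelicot.
From Stdlib Require Import Reals ZArith List QArith Qreals Lra Lia Permutation Sorted Classical.
Require Import Defs.
Open Scope R_scope.

(** * Zeros with multiplicity: Rolle and Hermite interpolation *)

(** Jensen's formula would count the zeros of the holomorphic extension of f to a strip; here
    everything stays on the real line, with derivative bounds in place of the extension. Rolle's
    theorem fails for complex values, hence the real and imaginary parts: both inherit every zero of
    f with its multiplicity, and where |f| >= c one of them is at least c/2 in absolute value. The
    difficulty is uniformity: the number of zeros allowed must depend on M, rho, c, T only and not
    on the position of the interval, so a lower bound for f at one point is not enough. Several
    indices k may share the frequency tau(k), and their coefficients may cancel. Since the character
    at g is constant on such a class, the class contributes to A(g) its Fourier coefficient in f
    times a number of modulus 1, so classes that cancel in f cancel in A(g) as well. The length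
    rho/4 leaves room for a binomial coefficient: J!/(n! i!) <= 2^J with J = n + i costs 2^n against
    4^n, and a decay of 2^(-n) remains. *)

Definition deriv_seq (D : nat -> R -> R) : Prop :=
  forall n x, derivable_pt_lim (D n) x (D (S n) x).

(** A function is carried together with the tower of all its derivatives, so differentiating is a
    shift of the index and every result about [D 0] applies to each derivative. *)
Definition shift (i : nat) (D : nat -> R -> R) (n : nat) : R -> R := D (i + n)%nat.

Definition mult (l : list R) (x : R) : nat := count_occ Req_dec_T l x.

Definition vanishes (D : nat -> R -> R) (l : list R) : Prop :=
  forall x j, (j < mult l x)%nat -> D j x = 0.

Lemma deriv_seq_shift D i : deriv_seq D -> deriv_seq (shift i D).
Proof.
  intros H n x. unfold shift. rewrite <- plus_n_Sm. apply H.
Qed.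

Lemma mult_cons_eq l x : mult (x :: l) x = S (mult l x).
Proof. unfold mult. now apply count_occ_cons_eq. Qed.

Lemma mult_cons_neq l x y : x <> y -> mult (x :: l) y = mult l y.
Proof. intros H. unfold mult. now apply count_occ_cons_neq. Qed.

Lemma mult_not_in l x : ~ In x l -> mult l x = 0%nat.
Proof. intros H. unfold mult. now apply count_occ_not_In. Qed.

Lemma mult_in l x : In x l -> (0 < mult l x)%nat.
Proof. exact (proj1 (count_occ_In Req_dec_T l x)). Qed.

Lemma rolle D x z : deriv_seq D -> x < z -> D 0%nat x = 0 -> D 0%nat z = 0 ->
  exists y, x < y < z /\ D 1%nat y = 0.
Proof.
  intros HD Hxz Hx Hz.
  destruct (MVT_cor2 (D 0%nat) (D 1%nat) x z Hxz) as [c [Hc Hi]].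
  { intros c _. apply HD. }
  exists c. split; [lra|].
  rewrite Hx, Hz in Hc. replace (0 - 0) with 0 in Hc by ring.
  symmetry in Hc. apply Rmult_integral in Hc. destruct Hc; lra.
Qed.

(** The location clause of [rolle_sorted] quantifies over upper bounds; one must exist before its
    lower bound can be read off. *)
Lemma list_upper_bound (l : list R) : exists b, forall y, In y l -> y <= b.
Proof.
  induction l as [|z l [b Hb]].
  - exists 0. intros y [].
  - exists (Rmax z b). intros y [<-|Hy]; [apply Rmax_l|].
    eapply Rle_trans; [now apply Hb|apply Rmax_r].
Qed.

(* A repeated zero loses one multiplicity; each gap between distinct zeros gives a new simple one. *)
Lemma rolle_sorted D : deriv_seq D -> forall l x,
  StronglySorted Rle (x :: l) -> vanishes D (x :: l) ->
  exists l', length l' = length l /\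
    (forall b, (forall y, In y (x :: l) -> y <= b) -> forall y, In y l' -> x <= y <= b) /\
    (forall y, (mult l' y <= pred (mult (x :: l) y))%nat \/
               ((mult l' y <= 1)%nat /\ D 1%nat y = 0 /\ x < y)).
Proof.
  intros HD l. induction l as [|z l IH]; intros x Hs Hv.
  - exists nil. repeat split; simpl; try tauto. left. apply Nat.le_0_l.
  - inversion Hs as [|? ? Hs' Hall]; subst.
    assert (Hxz : x <= z) by (inversion Hall; auto).
    destruct (IH z Hs') as [l' [Hlen [Hin Hm]]].
    { intros y j Hj. apply Hv. destruct (Req_dec_T x y) as [->|Hne].
      - rewrite mult_cons_eq. lia.
      - now rewrite mult_cons_neq. }
    destruct (Req_dec_T x z) as [->|Hne].
    + exists (z :: l'). split; [simpl; lia|split].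
      * intros b Hb y [<-|Hy].
        -- split; [lra|]. apply Hb. now left.
        -- apply Hin; auto. intros u Hu. apply Hb. now right.
      * intros y. destruct (Req_dec_T z y) as [<-|Hzy].
        (* The strict inequality kept in the second alternative shows here that the first point is
           never one of the new zeros, so its count may grow by one. *)
        -- left. destruct (Hm z) as [H|[_ [_ H]]]; [|lra].
           rewrite mult_cons_eq in H. rewrite !mult_cons_eq. lia.
        -- rewrite (mult_cons_neq l' z y), (mult_cons_neq (z :: l) z y) by auto.
           apply Hm.
    + assert (Hlt : x < z) by lra.
      destruct (rolle D x z HD Hlt) as [y0 [Hy0 HDy0]].
      { apply Hv. rewrite mult_cons_eq. lia. }
      { apply Hv. rewrite mult_cons_neq by auto. rewrite mult_cons_eq. lia. }
      exists (y0 :: l'). split; [simpl; lia|split].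
      * intros b Hb y [<-|Hy].
        -- assert (z <= b) by (apply Hb; right; now left). lra.
        -- assert (z <= y <= b); [|lra]. apply Hin; auto.
           intros u Hu. apply Hb. now right.
      * intros y. destruct (Req_dec_T y0 y) as [<-|Hyy].
        (* [y0] lies strictly before [z], while all of [l'] lies at or beyond [z]: so [y0] is not
           yet in [l'] and counts once. *)
        -- right. rewrite mult_cons_eq.
           rewrite (mult_not_in l').
           { repeat split; auto. lra. }
           intros Hy. assert (z <= y0); [|lra].
           destruct (list_upper_bound (z :: l)) as [b Hb].
           now apply (Hin b).
        -- rewrite (mult_cons_neq l' y0 y) by auto.
           destruct (Hm y) as [H|[H1 [H2 H3]]].
           ++ left. destruct (Req_dec_T x y) as [<-|Hxy].
              ** rewrite mult_cons_eq. lia.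
              ** rewrite (mult_cons_neq _ x y) by auto. exact H.
           ++ right. repeat split; auto. lra.
Qed.

Lemma insert_sorted (x : R) l : StronglySorted Rle l ->
  exists l', Permutation (x :: l) l' /\ StronglySorted Rle l'.
Proof.
  induction l as [|z l IH]; intros Hs.
  - exists (x :: nil). split; auto. repeat constructor.
  - inversion Hs as [|? ? Hs' Hall]; subst.
    destruct (Rle_dec x z) as [Hxz|Hxz].
    + exists (x :: z :: l). split; auto. constructor; auto. constructor; auto.
      eapply Forall_impl; [|exact Hall]. intros; simpl in *; lra.
    + destruct (IH Hs') as [l' [Hp Hl']].
      exists (z :: l'). split.
      * eapply perm_trans; [apply perm_swap|]. now apply perm_skip.
      * constructor; auto. apply (Permutation_Forall Hp). constructor; auto. lra.
Qed.

Lemma exists_sorted (l : list R) : exists l', Permutation l l' /\ StronglySorted Rle l'.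
Proof.
  induction l as [|x l [l' [Hp Hs]]].
  - exists nil. split; auto. constructor.
  - destruct (insert_sorted x l' Hs) as [l'' [Hp' Hs']].
    exists l''. split; auto. eapply perm_trans; [|exact Hp']. now apply perm_skip.
Qed.

Lemma rolle_multiset D l a b n : deriv_seq D -> vanishes D l -> length l = S n ->
  (forall y, In y l -> a <= y <= b) ->
  exists l', length l' = n /\ vanishes (shift 1 D) l' /\ (forall y, In y l' -> a <= y <= b).
Proof.
  intros HD Hv Hlen Hab.
  destruct (exists_sorted l) as [m [Hp Hs]].
  assert (Hv' : vanishes D m).
  { intros x j Hj. apply Hv. unfold mult in *.
    now rewrite (proj1 (Permutation_count_occ Req_dec_T l m) Hp x). }
  assert (Hlm : length m = S n) by (rewrite <- Hlen; symmetry; now apply Permutation_length).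
  assert (Habm : forall y, In y m -> a <= y <= b).
  { intros y Hy. apply Hab. eapply Permutation_in; [apply Permutation_sym|]; eauto. }
  destruct m as [|x m]; [discriminate|].
  destruct (rolle_sorted D HD m x Hs Hv') as [l' [H1 [H2 H3]]].
  exists l'. simpl in Hlm. split; [lia|split].
  - intros y j Hj. unfold shift. simpl.
    destruct (H3 y) as [H|[H4 [H5 _]]].
    + apply Hv'. lia.
    + replace j with 0%nat by lia. exact H5.
  - intros y Hy.
    assert (x <= y <= b).
    { apply H2; auto. intros u Hu. now apply Habm. }
    assert (a <= x) by (apply Habm; now left). lra.
Qed.

Lemma rolle_iterated i : forall D l a b n, deriv_seq D -> vanishes D l ->
  length l = (i + n)%nat -> (forall y, In y l -> a <= y <= b) ->
  exists l', length l' = n /\ vanishes (shift i D) l' /\ (forall y, In y l' -> a <= y <= b).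
Proof.
  induction i as [|i IH]; intros D l a b n HD Hv Hlen Hab.
  - exists l. auto.
  - destruct (rolle_multiset D l a b (i + n) HD Hv Hlen Hab) as [l' [H1 [H2 H3]]].
    destruct (IH (shift 1 D) l' a b n) as [l'' [H4 [H5 H6]]]; auto.
    + now apply deriv_seq_shift.
    + exists l''. exact (conj H4 (conj H5 H6)).
Qed.

(* [node_poly l n] is the [n]-th derivative of [t |-> prod_(z in l) (t - z)]. *)
Fixpoint node_poly (l : list R) (n : nat) (t : R) : R :=
  match l with
  | nil => match n with O => 1 | S _ => 0 end
  | z :: l' => (t - z) * node_poly l' n t + INR n * node_poly l' (pred n) t
  end.

(** Leibniz's rule with one linear factor, which has only two terms. At [n = 0] the meaningless
    index [pred 0] is multiplied by [INR 0]. *)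
Lemma node_poly_deriv l : deriv_seq (node_poly l).
Proof.
  intros n x. revert n. induction l as [|z l IH]; intros n.
  - destruct n; simpl; apply derivable_pt_lim_const.
  - simpl node_poly.
    replace ((x - z) * node_poly l (S n) x +
       match n with 0%nat => 1 | S _ => INR n + 1 end * node_poly l n x)
    with ((1 - 0) * node_poly l n x + (x - z) * node_poly l (S n) x
           + INR n * node_poly l n x)
      by (change (match n with 0%nat => 1 | S _ => INR n + 1 end) with (INR (S n));
          rewrite S_INR; ring).
    apply derivable_pt_lim_plus with (f1 := fun t => (t - z) * node_poly l n t)
       (f2 := fun t => INR n * node_poly l (pred n) t).
    + apply (derivable_pt_lim_mult (fun t => t - z) (node_poly l n)).
      * apply (derivable_pt_lim_minus id (fun _ => z)).
        -- apply derivable_pt_lim_id.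
        -- apply derivable_pt_lim_const.
      * apply IH.
    + destruct n as [|n].
      * simpl. replace (0 * node_poly l 0 x) with 0 by ring.
        apply (derivable_pt_lim_ext (fun _ => 0)); [intros; ring|].
        apply derivable_pt_lim_const.
      * apply (derivable_pt_lim_scal (node_poly l n)). apply IH.
Qed.

Lemma node_poly_high l : forall n t, (length l < n)%nat -> node_poly l n t = 0.
Proof.
  induction l as [|z l IH]; intros n t Hn; simpl in *.
  - destruct n; [lia|reflexivity].
  - rewrite !IH by lia. ring.
Qed.

Lemma node_poly_top l t : node_poly l (length l) t = INR (fact (length l)).
Proof.
  induction l as [|z l IH].
  - reflexivity.
  - change (node_poly (z :: l) (length (z :: l)) t) with
      ((t - z) * node_poly l (S (length l)) t + INR (S (length l)) * node_poly l (length l) t).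
    rewrite node_poly_high by lia. rewrite IH.
    change (length (z :: l)) with (S (length l)). rewrite fact_simpl, mult_INR. ring.
Qed.

Lemma node_poly_vanishes l : vanishes (node_poly l) l.
Proof.
  induction l as [|z l IH]; intros x j Hj.
  - simpl in Hj. lia.
  - simpl node_poly. destruct (Req_dec_T z x) as [->|Hne].
    + rewrite mult_cons_eq in Hj. destruct j as [|j]; [simpl; ring|].
      simpl pred. rewrite (IH x j) by lia. ring.
    + rewrite mult_cons_neq in Hj by auto.
      rewrite (IH x j) by lia. destruct j as [|j]; [simpl; ring|].
      simpl pred. rewrite (IH x j) by lia. ring.
Qed.

Lemma node_poly_nonzero l t : ~ In t l -> node_poly l 0 t <> 0.
Proof.
  induction l as [|z l IH]; intros Ht; simpl.
  - lra.
  - rewrite Rmult_0_l, Rplus_0_r. apply Rmult_integral_contrapositive_currified.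
    + intros H. apply Ht. left. lra.
    + apply IH. intros H. apply Ht. now right.
Qed.

Lemma node_poly_bound l a b t : (forall y, In y l -> a <= y <= b) -> a <= t <= b ->
  Rabs (node_poly l 0 t) <= (b - a) ^ length l.
Proof.
  intros Hl Ht. induction l as [|z l IH]; simpl.
  - rewrite Rabs_R1. lra.
  - rewrite Rmult_0_l, Rplus_0_r, Rabs_mult.
    apply Rmult_le_compat; try apply Rabs_pos.
    + assert (a <= z <= b) by (apply Hl; now left). apply Rabs_le. lra.
    + apply IH. intros y Hy. apply Hl. now right.
Qed.

(** The interpolant at zeros of the function is 0, so the error is the function itself. Off the
    nodes, [K] is chosen so that [E], the function minus [K] times the node polynomial, also
    vanishes at [y]. With one zero more than [length l], Rolle gives a zero [xi] of its derivative
    of order [length l], where the node polynomial contributes a factorial; this expresses [K]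
    through [D (length l) xi]. *)
Lemma hermite_bound D l a b y B : deriv_seq D -> vanishes D l ->
  (forall z, In z l -> a <= z <= b) -> a <= y <= b ->
  (forall t, Rabs (D (length l) t) <= B) ->
  Rabs (D 0%nat y) <= (b - a) ^ length l * B / INR (fact (length l)).
Proof.
  intros HD Hv Hl Hy HB.
  pose proof (INR_fact_lt_0 (length l)) as Hf.
  assert (HB0 : 0 <= B) by (eapply Rle_trans; [apply Rabs_pos|apply (HB y)]).
  assert (Hpow : 0 <= (b - a) ^ length l) by (apply pow_le; lra).
  destruct (in_dec Req_dec_T y l) as [Hin|Hnin].
  - rewrite (Hv y 0%nat) by now apply mult_in.
    rewrite Rabs_R0. apply Rdiv_le_0_compat; auto. now apply Rmult_le_pos.
  - pose proof (node_poly_nonzero l y Hnin) as Hw.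
    set (K := D 0%nat y / node_poly l 0 y).
    set (E := fun n t => D n t - K * node_poly l n t).
    assert (HE : deriv_seq E).
    { intros n x. unfold E. apply (derivable_pt_lim_minus (D n) (fun t => K * node_poly l n t)).
      - apply HD.
      - apply (derivable_pt_lim_scal (node_poly l n)). apply node_poly_deriv. }
    destruct (rolle_iterated (length l) E (y :: l) a b 1 HE) as [l' [H1 [H2 H3]]].
    + intros x j Hj. unfold E. destruct (Req_dec_T y x) as [->|Hne].
      * rewrite mult_cons_eq, mult_not_in in Hj by auto.
        replace j with 0%nat by lia. unfold K. field. exact Hw.
      * rewrite mult_cons_neq in Hj by auto.
        rewrite (Hv x j), (node_poly_vanishes l x j) by auto. ring.
    + simpl. lia.
    + intros z [<-|Hz]; auto.
    + destruct l' as [|xi l']; [discriminate|].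
      specialize (H2 xi 0%nat). rewrite mult_cons_eq in H2.
      specialize (H2 ltac:(lia)). unfold shift, E in H2. rewrite Nat.add_0_r in H2.
      rewrite node_poly_top in H2.
      assert (HK : K = D (length l) xi / INR (fact (length l))).
      { apply (Rmult_eq_reg_r (INR (fact (length l)))); [|lra].
        unfold Rdiv. rewrite Rmult_assoc, Rinv_l by lra. lra. }
      replace (D 0%nat y) with (node_poly l 0 y * K) by (unfold K; field; exact Hw).
      rewrite HK, Rabs_mult. unfold Rdiv. rewrite Rabs_mult.
      rewrite (Rabs_right (/ INR (fact (length l)))) by (left; now apply Rinv_0_lt_compat).
      rewrite <- Rmult_assoc.
      apply Rmult_le_compat_r; [left; now apply Rinv_0_lt_compat|].
      apply Rmult_le_compat; try apply Rabs_pos.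
      * now apply node_poly_bound.
      * apply HB.
Qed.

(** * From many zeros to a small jet, and its propagation *)

(** The shape of Cauchy's estimates for a function bounded by [M] on a strip of half-width [rho]. *)
Definition deriv_bound (M rho : R) (D : nat -> R -> R) : Prop :=
  forall n x, Rabs (D n x) <= M * INR (fact n) / rho ^ n.

Definition small_jet (eps : R) (J : nat) (D : nat -> R -> R) (x : R) : Prop :=
  forall i, (i < J)%nat -> Rabs (D i x) <= eps.

(* The Hermite or Taylor remainder of order [J - i] of the [i]-th derivative over a length [rho / 4]. *)
Definition jet_remainder (M rho : R) (i J : nat) : R :=
  (rho / 4) ^ (J - i) * (M * INR (fact J) / rho ^ J) / INR (fact (J - i)).

(** A binomial coefficient is at most a power of 2. As in Pascal's rule, the factor n + i + 2 splits
    into [S n + S i]; each induction hypothesis bounds one half, and the two equal bounds give the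
    new factor 2. *)
Lemma fact_add_le n : forall i, (fact (n + i) <= fact n * fact i * 2 ^ (n + i))%nat.
Proof.
  induction n as [|n IHn]; intros i.
  - rewrite Nat.add_0_l. pose proof (Nat.pow_nonzero 2 i ltac:(lia)). change (fact 0) with 1%nat.
    rewrite Nat.mul_1_l. rewrite <- (Nat.mul_1_r (fact i)) at 1. apply Nat.mul_le_mono_l. lia.
  - induction i as [|i IHi].
    + rewrite Nat.add_0_r. pose proof (Nat.pow_nonzero 2 (S n) ltac:(lia)). change (fact 0) with 1%nat.
      rewrite Nat.mul_1_r. rewrite <- (Nat.mul_1_r (fact (S n))) at 1. apply Nat.mul_le_mono_l. lia.
    + specialize (IHn (S i)).
      replace (S n + S i)%nat with (S (S n + i)) by lia.
      rewrite (Nat.pow_succ_r' 2 (S n + i)). rewrite fact_simpl.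
      replace (n + S i)%nat with (S n + i)%nat in IHn by lia.
      rewrite (fact_simpl n) in IHi |- *. rewrite (fact_simpl i) in IHn |- *.
      set (F := fact (S n + i)) in *. set (T := (2 ^ (S n + i))%nat) in *.
      set (a := fact n) in *. set (b := fact i) in *. clearbody F T a b.
      replace (S (S n + i)) with (S n + S i)%nat by lia.
      assert (S n * F <= S n * (a * (S i * b) * T))%nat by (apply Nat.mul_le_mono_l; exact IHn).
      assert (S i * F <= S i * (S n * a * b * T))%nat by (apply Nat.mul_le_mono_l; exact IHi).
      rewrite Nat.mul_add_distr_r.
      eapply Nat.le_trans; [apply Nat.add_le_mono; eassumption|].
      apply Nat.eq_le_incl. ring.
Qed.

(** With n = J - i, [fact_add_le] bounds J!/n! by i! 2^i 2^n, and (rho/4)^n / rho^n = 4^(-n); what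
    is left is [A] times 2^(-n). *)
Lemma jet_remainder_small M rho i eps : 0 <= M -> 0 < rho -> 0 < eps ->
  exists J0, forall J, (J0 <= J)%nat -> (i < J)%nat /\ jet_remainder M rho i J <= eps.
Proof.
  intros HM Hrho Heps.
  set (A := M / rho ^ i * INR (fact i) * 2 ^ i).
  assert (HA : 0 <= A).
  { unfold A. pose proof (INR_fact_lt_0 i). pose proof (pow_lt rho i Hrho).
    pose proof (pow_lt 2 i ltac:(lra)).
    repeat apply Rmult_le_pos; try lra. left. now apply Rinv_0_lt_compat. }
  (* [A + 1] and not [A], which is 0 when [M] is 0. *)
  destruct (pow_lt_1_zero (/2)) with (y := eps / (A + 1)) as [N HN].
  { rewrite Rabs_right; lra. }
  { apply Rdiv_lt_0_compat; lra. }
  exists (N + i + 1)%nat. intros J HJ. split; [lia|].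
  set (n := (J - i)%nat). replace J with (n + i)%nat by (unfold n; lia).
  unfold jet_remainder. replace (n + i - i)%nat with n by lia.
  assert (Hn : (/2) ^ n < eps / (A + 1)).
  { eapply Rle_lt_trans; [apply Rle_abs|]. apply HN. unfold n. lia. }
  pose proof (INR_fact_lt_0 n) as Hfn. pose proof (pow_lt rho i Hrho).
  pose proof (pow_lt rho n Hrho). pose proof (pow_lt 2 n ltac:(lra)).
  pose proof (pow_lt 2 i ltac:(lra)).
  assert (Hfact : INR (fact (n + i)) <= INR (fact n) * INR (fact i) * (2 ^ n * 2 ^ i)).
  { rewrite <- pow_add. change 2 with (INR 2). rewrite <- pow_INR, <- !mult_INR. apply le_INR, fact_add_le. }
  apply Rle_trans with (A * (/2) ^ n).
  - replace ((rho / 4) ^ n * (M * INR (fact (n + i)) / rho ^ (n + i)) / INR (fact n))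
      with (M / rho ^ i / (2 ^ n * 2 ^ n) / INR (fact n) * INR (fact (n + i))).
    + replace (A * (/2) ^ n) with
        (M / rho ^ i / (2 ^ n * 2 ^ n) / INR (fact n) *
           (INR (fact n) * INR (fact i) * (2 ^ n * 2 ^ i))).
      * apply Rmult_le_compat_l; auto.
        unfold Rdiv. repeat apply Rmult_le_pos; try lra; left; apply Rinv_0_lt_compat; auto.
        now apply Rmult_lt_0_compat.
      * unfold A. rewrite pow_inv. field. lra.
    + unfold Rdiv at 5. rewrite Rpow_mult_distr, pow_add, pow_inv.
      replace 4 with (2 * 2) by ring. rewrite Rpow_mult_distr. field. lra.
  - apply Rle_trans with (A * (eps / (A + 1))).
    + apply Rmult_le_compat_l; lra.
    + apply (Rmult_le_reg_r (A + 1)); [lra|].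
      replace (A * (eps / (A + 1)) * (A + 1)) with (A * eps) by (field; lra). lra.
Qed.

Lemma jet_remainder_small_uniform M rho J' eps : 0 <= M -> 0 < rho -> 0 < eps ->
  exists J0, forall J, (J0 <= J)%nat -> forall i, (i < J')%nat ->
    (i < J)%nat /\ jet_remainder M rho i J <= eps.
Proof.
  intros HM Hrho Heps. induction J' as [|J' [J0 HJ0]].
  - exists 0%nat. intros; lia.
  - destruct (jet_remainder_small M rho J' eps HM Hrho Heps) as [J1 HJ1].
    exists (J0 + J1)%nat. intros J HJ i Hi.
    destruct (Nat.eq_dec i J') as [->|Hne].
    + apply HJ1. lia.
    + apply HJ0; lia.
Qed.

(** The derivative of order [i] inherits [length l - i] zeros in the same interval, so Hermite's
    bound applies to it as well. The threshold [N] is fixed before [D], [l] and [x]. *)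
Lemma small_jet_of_zeros M rho eps J : 0 <= M -> 0 < rho -> 0 < eps ->
  exists N, forall D l x, deriv_seq D -> deriv_bound M rho D ->
    vanishes D l -> (N <= length l)%nat ->
    (forall z, In z l -> x <= z <= x + rho / 4) -> small_jet eps J D x.
Proof.
  intros HM Hrho Heps.
  destruct (jet_remainder_small_uniform M rho J eps HM Hrho Heps) as [N HN].
  exists N. intros D l x HD HB Hv Hlen Hl i Hi.
  destruct (HN _ Hlen i Hi) as [Hil Hrem].
  destruct (rolle_iterated i D l x (x + rho / 4) (length l - i) HD Hv)
    as [l' [H1 [H2 H3]]]; auto; [lia|].
  eapply Rle_trans; [|exact Hrem]. unfold jet_remainder. rewrite <- H1.
  replace (D i x) with (shift i D 0%nat x) by (unfold shift; f_equal; lia).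
  replace (rho / 4) with (x + rho / 4 - x) at 1 by ring.
  apply hermite_bound with (1 := deriv_seq_shift D i HD); auto; [lra|].
  intros t. unfold shift. rewrite H1. replace (i + (length l - i))%nat with (length l) by lia.
  apply HB.
Qed.

Lemma deriv_seq_Derive_n D n : deriv_seq D ->
  forall x, ex_derive_n (D 0%nat) n x /\ Derive_n (D 0%nat) n x = D n x.
Proof.
  intros HD. induction n as [|n IH]; intros x; simpl; auto.
  assert (He : forall t, D n t = Derive_n (D 0%nat) n t) by (intros t; symmetry; apply IH).
  assert (Hd : is_derive (Derive_n (D 0%nat) n) x (D (S n) x)).
  { apply (is_derive_ext (D n)); auto. apply is_derive_Reals. apply HD. }
  split.
  - now exists (D (S n) x).
  - now apply is_derive_unique.
Qed.

Lemma taylor_bound D n x h delta B : deriv_seq D -> 0 <= h ->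
  (forall m, (m <= n)%nat -> Rabs (D m x) <= delta) ->
  (forall t, Rabs (D (S n) t) <= B) ->
  Rabs (D 0%nat (x + h)) <=
    delta * sum_f_R0 (fun m => h ^ m / INR (fact m)) n + h ^ S n * B / INR (fact (S n)).
Proof.
  intros HD Hh Hdelta HB.
  assert (HB0 : 0 <= B) by (eapply Rle_trans; [apply Rabs_pos|apply (HB x)]).
  assert (Hd0 : 0 <= delta)
    by (eapply Rle_trans; [apply Rabs_pos|apply (Hdelta 0%nat); lia]).
  assert (Hterm : forall m, 0 <= h ^ m / INR (fact m)).
  { intros m. apply Rdiv_le_0_compat; [now apply pow_le|apply INR_fact_lt_0]. }
  (* [Taylor_Lagrange] needs two distinct points. At [h = 0] the sum is 1, its first term being
     0^0. *)
  destruct (Req_dec h 0) as [->|Hne].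
  - rewrite Rplus_0_r, pow_i by lia.
    replace (sum_f_R0 (fun m => 0 ^ m / INR (fact m)) n) with 1.
    + unfold Rdiv. rewrite !Rmult_0_l, Rplus_0_r, Rmult_1_r. apply Hdelta. lia.
    + clear. induction n as [|n IH]; simpl; [field|].
      simpl in IH. rewrite <- IH. unfold Rdiv. ring.
  - destruct (Taylor_Lagrange (D 0%nat) n x (x + h)) as [xi [_ Hxi]]; [lra| |].
    { intros t _ k _. now apply deriv_seq_Derive_n. }
    rewrite Hxi. replace (x + h - x) with h by ring.
    eapply Rle_trans; [apply Rabs_triang|]. apply Rplus_le_compat.
    + eapply Rle_trans; [apply Rsum_abs|]. rewrite scal_sum. apply sum_Rle.
      intros m Hm. rewrite (proj2 (deriv_seq_Derive_n D m HD x)).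
      rewrite Rabs_mult, (Rabs_right (h ^ m / INR (fact m))) by (apply Rle_ge, Hterm).
      apply Rmult_le_compat_l; auto.
    + rewrite (proj2 (deriv_seq_Derive_n D (S n) HD xi)).
      rewrite Rabs_mult, (Rabs_right (h ^ S n / INR (fact (S n)))) by (apply Rle_ge, Hterm).
      replace (h ^ S n * B / INR (fact (S n))) with (h ^ S n / INR (fact (S n)) * B)
        by (unfold Rdiv; ring).
      apply Rmult_le_compat_l; auto.
Qed.

(** Half of [eps] pays for the Taylor remainder, which fixes [J]. The Taylor polynomial is at most
    [delta] times the exponential sum, hence [delta] times [exp (rho / 4)], which fixes [delta]. For
    the derivative of order [i] the expansion stops at order [J - i - 1], so that its remainder
    involves exactly [D J]. *)
Lemma small_jet_step M rho eps J' : 0 <= M -> 0 < rho -> 0 < eps ->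
  exists delta J, 0 < delta /\ forall D x h, deriv_seq D -> deriv_bound M rho D ->
    0 <= h <= rho / 4 -> small_jet delta J D x -> small_jet eps J' D (x + h).
Proof.
  intros HM Hrho Heps.
  destruct (jet_remainder_small_uniform M rho J' (eps / 2) HM Hrho ltac:(lra)) as [J HJ].
  specialize (HJ J (Nat.le_refl _)).
  set (E := exp (rho / 4)). assert (HE : 0 < E) by apply exp_pos.
  exists (eps / 2 / E), J. split; [apply Rdiv_lt_0_compat; lra|].
  intros D x h HD HB Hh Hsmall i Hi. destruct (HJ i Hi) as [HiJ Hrem].
  replace (D i (x + h)) with (shift i D 0%nat (x + h)) by (unfold shift; f_equal; lia).
  assert (HB' : forall t, Rabs (D J t) <= M * INR (fact J) / rho ^ J) by (intros; apply HB).
  assert (HBpos : 0 <= M * INR (fact J) / rho ^ J)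
    by (eapply Rle_trans; [apply Rabs_pos|apply (HB' x)]).
  eapply Rle_trans.
  { apply (taylor_bound (shift i D) (J - i - 1) x h (eps / 2 / E) (M * INR (fact J) / rho ^ J)).
    - now apply deriv_seq_shift.
    - lra.
    - intros m Hm. apply Hsmall. lia.
    - intros t. unfold shift. replace (i + S (J - i - 1))%nat with J by lia. auto. }
  replace (S (J - i - 1)) with (J - i)%nat by lia.
  replace eps with (eps / 2 / E * E + eps / 2) at 2 by (field; lra).
  apply Rplus_le_compat.
  - apply Rmult_le_compat_l; [left; apply Rdiv_lt_0_compat; lra|].
    eapply Rle_trans; [apply exp_ge_taylor; lra|].
    destruct (Req_dec h (rho / 4)) as [->|Hne]; [apply Rle_refl|].
    left. apply exp_increasing. lra.
  - eapply Rle_trans; [|exact Hrem]. unfold jet_remainder, Rdiv at 1 3.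
    apply Rmult_le_compat_r; [left; apply Rinv_0_lt_compat, INR_fact_lt_0|].
    apply Rmult_le_compat_r; auto. apply pow_incr. lra.
Qed.

Lemma small_jet_propagates M rho eps n : 0 <= M -> 0 < rho -> 0 < eps ->
  exists delta J, 0 < delta /\ forall D x h, deriv_seq D -> deriv_bound M rho D ->
    0 <= h <= INR n * (rho / 4) -> small_jet delta J D x -> Rabs (D 0%nat (x + h)) <= eps.
Proof.
  intros HM Hrho Heps.
  (* Every step needs more derivatives at its start than it controls at its end, so the induction
     must conclude about jets of arbitrary length. *)
  enough (H : forall J', exists delta J, 0 < delta /\ forall D x h,
    deriv_seq D -> deriv_bound M rho D ->
    0 <= h <= INR n * (rho / 4) -> small_jet delta J D x -> small_jet eps J' D (x + h)).
  { destruct (H 1%nat) as [delta [J [Hd HJ]]]. exists delta, J. split; auto.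
    intros D x h H1 H2 H3 H4. apply (HJ D x h H1 H2 H3 H4 0%nat). lia. }
  induction n as [|n IH]; intros J'.
  - exists eps, J'. split; auto. intros D x h _ _ Hh Hs. simpl in Hh.
    replace (x + h) with x by lra. exact Hs.
  - destruct (IH J') as [delta [J [Hd HJ]]].
    destruct (small_jet_step M rho delta J HM Hrho Hd) as [delta' [J'' [Hd' HJ'']]].
    exists delta', J''. split; auto. intros D x h HD HB Hh Hs.
    rewrite S_INR in Hh.
    destruct (Rle_dec h (rho / 4)) as [Hle|Hgt].
    (* A short [h] takes a single step; the remaining [n] steps are used with length 0, only to
       match the induction hypothesis. *)
    + replace (x + h) with (x + h + 0) by ring.
      apply (HJ D (x + h) 0 HD HB).
      * split; [lra|]. apply Rmult_le_pos; [apply pos_INR|lra].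
      * now apply HJ''.
    + replace (x + h) with (x + rho / 4 + (h - rho / 4)) by ring.
      apply HJ; auto; [lra|]. apply HJ''; auto. lra.
Qed.

(** The order of choices gives uniformity: [n] steps of length rho/4 cover [T], these fix [delta]
    and [J], and these fix [N]; all precede the functions and [x]. Both functions must become small,
    since either one may carry the lower bound at [y]. *)
Lemma zeros_bounded M rho c T : 0 <= M -> 0 < rho -> 0 < c ->
  exists N, forall D1 D2 l x,
    deriv_seq D1 -> deriv_bound M rho D1 -> deriv_seq D2 -> deriv_bound M rho D2 ->
    (forall x, exists y, x <= y <= x + T /\ (c <= Rabs (D1 0%nat y) \/ c <= Rabs (D2 0%nat y))) ->
    vanishes D1 l -> vanishes D2 l -> (forall z, In z l -> x <= z <= x + rho / 4) ->
    (length l < N)%nat.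
Proof.
  intros HM Hrho Hc.
  destruct (INR_unbounded (T / (rho / 4))) as [n Hn].
  destruct (small_jet_propagates M rho (c / 2) n HM Hrho ltac:(lra)) as [delta [J [Hd HJ]]].
  destruct (small_jet_of_zeros M rho delta J HM Hrho Hd) as [N HN].
  exists N. intros D1 D2 l x H1 B1 H2 B2 Hlow V1 V2 Hl.
  destruct (Nat.lt_ge_cases (length l) N) as [?|HlN]; auto. exfalso.
  destruct (Hlow x) as [y [Hy Hcy]].
  assert (HnT : T <= INR n * (rho / 4)).
  { left. apply (Rmult_lt_reg_r (/ (rho / 4))); [apply Rinv_0_lt_compat; lra|].
    rewrite Rmult_assoc, Rinv_r by lra. unfold Rdiv at 1 in Hn. lra. }
  assert (Hsm : forall D, deriv_seq D -> deriv_bound M rho D -> vanishes D l ->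
    Rabs (D 0%nat y) <= c / 2).
  { intros D HD HB HV. replace y with (x + (y - x)) by ring.
    apply HJ; auto; [lra|]. apply (HN D l x); auto. }
  pose proof (Hsm D1 H1 B1 V1). pose proof (Hsm D2 H2 B2 V2).
  destruct Hcy; lra.
Qed.

(** * Counting zeros *)

Definition expand (zs : list (R * nat)) : list R :=
  flat_map (fun p => repeat (fst p) (snd p)) zs.

Definition total (zs : list (R * nat)) : nat := fold_right Nat.add 0%nat (map snd zs).

Lemma length_expand zs : length (expand zs) = total zs.
Proof.
  induction zs as [|p zs IH]; auto. unfold expand, total in *. simpl.
  now rewrite length_app, repeat_length, IH.
Qed.

Lemma in_expand zs x : In x (expand zs) -> exists p, In p zs /\ fst p = x.
Proof.
  unfold expand. rewrite in_flat_map. intros [p [Hp Hx]]. exists p. split; auto.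
  symmetry. now apply repeat_spec in Hx.
Qed.

Lemma mult_repeat x y n l : mult (repeat x n ++ l) y =
  ((if Req_dec_T x y then n else 0) + mult l y)%nat.
Proof.
  induction n as [|n IH]; simpl app.
  - destruct (Req_dec_T x y); reflexivity.
  - destruct (Req_dec_T x y) as [<-|Hne].
    + now rewrite mult_cons_eq, IH.
    + now rewrite mult_cons_neq.
Qed.

(** As the points are distinct, all copies of [x] in the flattened list come from one pair, whose
    second entry is thus the count of [x]. *)
Lemma mult_expand zs x j : NoDup (map fst zs) -> (j < mult (expand zs) x)%nat ->
  exists p, In p zs /\ fst p = x /\ (j < snd p)%nat.
Proof.
  induction zs as [|p zs IH]; intros Hnd Hj.
  - simpl in Hj. lia.
  - inversion Hnd as [|? ? Hnin Hnd']; subst.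
    change (expand (p :: zs)) with (repeat (fst p) (snd p) ++ expand zs) in Hj.
    rewrite mult_repeat in Hj. destruct (Req_dec_T (fst p) x) as [<-|Hne].
    + exists p. split; [now left|]. split; auto.
      rewrite mult_not_in in Hj; [lia|].
      intros Hin. apply in_expand in Hin. destruct Hin as [q [Hq Hqp]].
      apply Hnin. rewrite <- Hqp. now apply in_map.
    + destruct IH as [q [Hq Hq']]; auto. exists q. split; auto. now right.
Qed.

Lemma total_filter (f : R * nat -> bool) zs :
  total zs = (total (filter f zs) + total (filter (fun p => negb (f p)) zs))%nat.
Proof.
  induction zs as [|p zs IH]; auto. unfold total in *. simpl.
  destruct (f p); simpl; lia.
Qed.

Lemma NoDup_map_filter (f : R * nat -> bool) zs :
  NoDup (map fst zs) -> NoDup (map fst (filter f zs)).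
Proof.
  induction zs as [|p zs IH]; intros Hnd; simpl; auto.
  inversion Hnd as [|? ? Hnin Hnd']; subst. destruct (f p); auto.
  simpl. constructor; auto. rewrite in_map_iff. intros [q [Hq Hin]].
  apply Hnin. rewrite <- Hq. apply in_map. apply filter_In in Hin. tauto.
Qed.

(** The first half-open piece is split off by a filter, so no boundary point is counted twice; each
    piece lies in a closed interval to which the local bound applies. *)
Lemma count_by_cover (P : R * nat -> Prop) ell B n : 0 < ell ->
  (forall x zs, NoDup (map fst zs) ->
     (forall p, In p zs -> P p /\ x <= fst p <= x + ell) -> (total zs <= B)%nat) ->
  forall x zs, NoDup (map fst zs) ->
     (forall p, In p zs -> P p /\ x <= fst p < x + INR n * ell) -> (total zs <= n * B)%nat.
Proof.
  intros Hell Hloc. induction n as [|n IH]; intros x zs Hnd Hzs.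
  - destruct zs as [|p zs]; [unfold total; simpl; lia|].
    destruct (Hzs p) as [_ H]; [now left|]. simpl in H. lra.
  - set (f := fun p : R * nat => if Rlt_dec (fst p) (x + ell) then true else false).
    rewrite (total_filter f).
    assert ((total (filter f zs) <= B)%nat).
    { apply (Hloc x); [now apply NoDup_map_filter|].
      intros p Hp. apply filter_In in Hp. destruct Hp as [Hp Hf].
      destruct (Hzs p Hp) as [HP Hx]. split; auto. unfold f in Hf.
      destruct (Rlt_dec (fst p) (x + ell)); [lra|discriminate]. }
    assert ((total (filter (fun p => negb (f p)) zs) <= n * B)%nat).
    { apply (IH (x + ell)); [now apply NoDup_map_filter|].
      intros p Hp. apply filter_In in Hp. destruct Hp as [Hp Hf].
      destruct (Hzs p Hp) as [HP Hx]. split; auto. unfold f in Hf. rewrite S_INR in Hx.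
      destruct (Rlt_dec (fst p) (x + ell)); [discriminate|lra]. }
    lia.
Qed.

Lemma upper_density_finite_of_local_bound f ell B : 0 < ell ->
  (forall x zs, NoDup (map fst zs) ->
     (forall p, In p zs -> zero_mult_ge f (fst p) (snd p) /\ x <= fst p <= x + ell) ->
     (total zs <= B)%nat) ->
  upper_density_finite f.
Proof.
  (* The interval is covered by [up (2 L / ell)] pieces, at most 2L/ell + 1; the summand 1 is
     absorbed into 2L because L >= 1. *)
  intros Hell Hloc. exists (INR B * (/ ell + 1)), 1. intros L HL zs Hnd Hzs.
  set (r := 2 * L / ell).
  assert (Hr : 0 < r) by (apply Rdiv_lt_0_compat; lra).
  destruct (archimed r) as [Hup1 Hup2].
  set (n := Z.to_nat (up r)).
  assert (Hn : INR n = IZR (up r)).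
  { unfold n. rewrite INR_IZR_INZ, Z2Nat.id; auto. apply le_IZR. lra. }
  assert (Hcount : (total zs <= n * B)%nat).
  { apply (count_by_cover (fun p => zero_mult_ge f (fst p) (snd p)) ell B n Hell Hloc (- L));
      auto.
    intros p Hp. destruct (Hzs p Hp) as [Hp1 Hp2]. split; auto. rewrite Hn.
    assert (r * ell = 2 * L) by (unfold r; field; lra).
    assert (r * ell < IZR (up r) * ell) by (apply Rmult_lt_compat_r; lra). lra. }
  apply le_INR in Hcount. rewrite mult_INR, Hn in Hcount.
  change (INR (total zs) <= INR B * (/ ell + 1) * (2 * L)).
  eapply Rle_trans; [exact Hcount|].
  rewrite Rmult_comm, Rmult_assoc. apply Rmult_le_compat_l; [apply pos_INR|].
  replace ((/ ell + 1) * (2 * L)) with (r + 2 * L) by (unfold r; field; lra). lra.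
Qed.

(** [zero_mult_ge] only asserts that some derivative of order [n] vanishes; uniqueness of
    derivatives identifies it with the given towers. *)
Lemma nth_deriv_unique f n g D1 D2 : deriv_seq D1 -> deriv_seq D2 ->
  (forall y, Cre (f y) = D1 0%nat y) -> (forall y, Cim (f y) = D2 0%nat y) ->
  nth_deriv f n g -> forall y, Cre (g y) = D1 n y /\ Cim (g y) = D2 n y.
Proof.
  intros H1 H2 E1 E2. revert g. induction n as [|n IH]; intros g Hg y; simpl in Hg.
  - rewrite Hg. auto.
  - destruct Hg as [h [Hh Hd]]. destruct (Hd y) as [Hre Him].
    split.
    + apply (uniqueness_limite (D1 n) y); [|apply H1].
      apply (derivable_pt_lim_ext (fun t => Cre (h t))); auto. intros t. now apply IH.
    + apply (uniqueness_limite (D2 n) y); [|apply H2].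
      apply (derivable_pt_lim_ext (fun t => Cim (h t))); auto. intros t. now apply IH.
Qed.

Lemma upper_density_finite_of_lower_bound f M rho c T D1 D2 : 0 <= M -> 0 < rho -> 0 < c ->
  deriv_seq D1 -> deriv_bound M rho D1 -> deriv_seq D2 -> deriv_bound M rho D2 ->
  (forall y, Cre (f y) = D1 0%nat y) -> (forall y, Cim (f y) = D2 0%nat y) ->
  (forall x, exists y, x <= y <= x + T /\ c <= Cmod (f y)) ->
  upper_density_finite f.
Proof.
  intros HM Hrho Hc HD1 HB1 HD2 HB2 E1 E2 Hlow.
  (* If both parts were below c/2 in absolute value, then |f|^2 would be below c^2/2. *)
  destruct (zeros_bounded M rho (c / 2) T HM Hrho ltac:(lra)) as [N HN].
  apply (upper_density_finite_of_local_bound f (rho / 4) N); [lra|].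
  intros x zs Hnd Hzs. rewrite <- length_expand. apply Nat.lt_le_incl.
  assert (HV : forall y j, (j < mult (expand zs) y)%nat -> D1 j y = 0 /\ D2 j y = 0).
  { intros y j Hj. destruct (mult_expand zs y j Hnd Hj) as [p [Hp [<- Hjp]]].
    destruct (Hzs p Hp) as [Hz _]. destruct (Hz j Hjp) as [g [Hg Hg0]].
    destruct (nth_deriv_unique f j g D1 D2 HD1 HD2 E1 E2 Hg (fst p)) as [<- <-].
    rewrite Hg0. auto. }
  apply (HN D1 D2 (expand zs) x); auto.
  - intros u. destruct (Hlow u) as [y [Hy Hcy]]. exists y. split; auto.
    rewrite <- E1, <- E2.
    destruct (Rle_dec (c / 2) (Rabs (Cre (f y)))) as [?|H1]; [now left|].
    destruct (Rle_dec (c / 2) (Rabs (Cim (f y)))) as [?|H2]; [now right|].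
    exfalso. unfold Cmod in Hcy.
    assert (Hlt : sqrt (Cre (f y) ^ 2 + Cim (f y) ^ 2) < sqrt (c ^ 2)).
    { apply sqrt_lt_1; [nra|nra|].
      rewrite <- (pow2_abs (Cre (f y))), <- (pow2_abs (Cim (f y))).
      pose proof (Rabs_pos (Cre (f y))). pose proof (Rabs_pos (Cim (f y))). nra. }
    rewrite sqrt_pow2 in Hlt; lra.
  - intros y j Hj. now apply HV.
  - intros y j Hj. now apply HV.
  - intros z Hz. destruct (in_expand zs z Hz) as [p [Hp <-]]. now apply Hzs.
Qed.

(** * Trigonometric series *)

(** Two mean value steps: one for the function minus its linear part, one for its derivative. The
    error is explicit, so that it can be summed over the terms of a series. *)
Lemma second_order_bound D n y h B : deriv_seq D -> (forall t, Rabs (D (S (S n)) t) <= B) ->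
  Rabs (D n (y + h) - D n y - h * D (S n) y) <= B * h ^ 2.
Proof.
  intros HD HB.
  destruct (MVT_abs (fun t => D n t - t * D (S n) y) (fun t => D (S n) t - 1 * D (S n) y)
              y (y + h)) as [c [Hc Hin]].
  { intros c _. apply (derivable_pt_lim_minus (D n) (fun t => t * D (S n) y)).
    - apply HD.
    - replace (1 * D (S n) y) with (1 * D (S n) y + c * 0) by ring.
      apply (derivable_pt_lim_mult id (fun _ => D (S n) y)).
      + apply derivable_pt_lim_id.
      + apply derivable_pt_lim_const. }
  destruct (MVT_abs (D (S n)) (D (S (S n))) y c) as [e [He _]].
  { intros e _. apply HD. }
  rewrite Rmult_1_l in Hc.
  replace (D n (y + h) - D n y - h * D (S n) y) with
    (D n (y + h) - (y + h) * D (S n) y - (D n y - y * D (S n) y)) by ring.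
  rewrite Hc, He. replace (y + h - y) with h by ring.
  assert (Hcy : Rabs (c - y) <= Rabs h).
  { unfold Rmin, Rmax in Hin. destruct (Rle_dec y (y + h)).
    - rewrite !Rabs_right; lra.
    - rewrite !Rabs_left1; lra. }
  rewrite <- (pow2_abs h). simpl. rewrite Rmult_1_r, Rmult_assoc.
  apply Rmult_le_compat; auto using Rabs_pos.
  - apply Rmult_le_pos; apply Rabs_pos.
  - apply Rmult_le_compat_r; auto using Rabs_pos.
Qed.

(** With [second_order_bound] this replaces a theorem on termwise differentiation: the quadratic
    errors of the terms add up to a quadratic error of the sum. *)
Lemma derivable_of_quadratic f y l K : 0 <= K ->
  (forall h, Rabs (f (y + h) - f y - h * l) <= K * h ^ 2) -> derivable_pt_lim f y l.
Proof.
  intros HK Hq eps Heps.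
  assert (Hd : 0 < eps / (K + 1)) by (apply Rdiv_lt_0_compat; lra).
  exists (mkposreal _ Hd). simpl. intros h Hh Hlt.
  replace ((f (y + h) - f y) / h - l) with ((f (y + h) - f y - h * l) / h) by (field; auto).
  unfold Rdiv. rewrite Rabs_mult, Rabs_inv.
  assert (Hp : 0 < Rabs h) by now apply Rabs_pos_lt.
  apply Rle_lt_trans with (K * Rabs h).
  - apply (Rmult_le_reg_r (Rabs h)); auto. rewrite Rmult_assoc, Rinv_l by lra.
    rewrite Rmult_1_r. eapply Rle_trans; [apply Hq|]. rewrite <- (pow2_abs h). simpl. lra.
  - apply Rle_lt_trans with ((K + 1) * Rabs h); [nra|].
    apply Rlt_le_trans with ((K + 1) * (eps / (K + 1))).
    + apply Rmult_lt_compat_l; lra.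
    + right. field. lra.
Qed.

Fixpoint trig_coef (p q w : R) (n : nat) : R * R :=
  match n with
  | O => (p, q)
  | S m => (w * snd (trig_coef p q w m), - (w * fst (trig_coef p q w m)))
  end.

(* The [n]-th derivative of [y |-> p cos (w y) + q sin (w y)]. *)
Definition trig_term (p q w : R) (n : nat) (y : R) : R :=
  fst (trig_coef p q w n) * cos (w * y) + snd (trig_coef p q w n) * sin (w * y).

Lemma trig_term_deriv p q w : deriv_seq (trig_term p q w).
Proof.
  intros n y. unfold trig_term. simpl. apply is_derive_Reals. auto_derive; auto. ring.
Qed.

Lemma trig_coef_bound p q w b n : Rabs p <= b -> Rabs q <= b ->
  Rabs (fst (trig_coef p q w n)) <= b * Rabs w ^ n /\
  Rabs (snd (trig_coef p q w n)) <= b * Rabs w ^ n.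
Proof.
  intros Hp Hq. induction n as [|n [IH1 IH2]]; simpl.
  - rewrite Rmult_1_r. auto.
  - rewrite Rabs_Ropp, !Rabs_mult.
    replace (b * (Rabs w * Rabs w ^ n)) with (Rabs w * (b * Rabs w ^ n)) by ring.
    split; apply Rmult_le_compat_l; auto using Rabs_pos.
Qed.

Lemma trig_term_bound p q w b n y : Rabs p <= b -> Rabs q <= b ->
  Rabs (trig_term p q w n y) <= 2 * (b * Rabs w ^ n).
Proof.
  intros Hp Hq. destruct (trig_coef_bound p q w b n Hp Hq) as [H1 H2].
  unfold trig_term. eapply Rle_trans; [apply Rabs_triang|]. rewrite !Rabs_mult.
  assert (Hc : Rabs (cos (w * y)) <= 1) by (apply Rabs_le; apply COS_bound).
  assert (Hs : Rabs (sin (w * y)) <= 1) by (apply Rabs_le; apply SIN_bound).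
  pose proof (Rabs_pos (fst (trig_coef p q w n))).
  pose proof (Rabs_pos (snd (trig_coef p q w n))). nra.
Qed.

Lemma pow_le_fact_exp x n : 0 <= x -> x ^ n <= INR (fact n) * exp x.
Proof.
  intros Hx. pose proof (INR_fact_lt_0 n) as Hf.
  assert (H : x ^ n / INR (fact n) <= exp x).
  { eapply Rle_trans; [|apply (exp_ge_taylor x n Hx)].
    destruct n as [|n]; [simpl; lra|]. simpl sum_f_R0.
    assert (0 <= sum_f_R0 (fun k => x ^ k / INR (fact k)) n); [|simpl in *; lra].
    apply cond_pos_sum. intros k. apply Rdiv_le_0_compat; [now apply pow_le|apply INR_fact_lt_0]. }
  apply (Rmult_le_compat_l (INR (fact n))) in H; [|lra].
  replace (INR (fact n) * (x ^ n / INR (fact n))) with (x ^ n) in H by (field; lra). exact H.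
Qed.

(** One term of the exponential series at rho |w|: the power of the frequency produced by [n]
    derivatives is traded for n!/rho^n and the exponential weight that the decay hypothesis makes
    summable. *)
Lemma pow_freq_bound b w rho n : 0 <= b -> 0 < rho ->
  b * Rabs w ^ n <= INR (fact n) / rho ^ n * (b * exp (rho * Rabs w)).
Proof.
  intros Hb Hrho. pose proof (pow_lt rho n Hrho).
  assert (H1 : (rho * Rabs w) ^ n <= INR (fact n) * exp (rho * Rabs w)).
  { apply pow_le_fact_exp. apply Rmult_le_pos; [lra|apply Rabs_pos]. }
  rewrite Rpow_mult_distr in H1.
  apply (Rmult_le_reg_l (rho ^ n)); auto.
  replace (rho ^ n * (INR (fact n) / rho ^ n * (b * exp (rho * Rabs w)))) with
    (b * (INR (fact n) * exp (rho * Rabs w))) by (field; lra).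
  replace (rho ^ n * (b * Rabs w ^ n)) with (b * (rho ^ n * Rabs w ^ n)) by ring.
  now apply Rmult_le_compat_l.
Qed.

Definition trig_series (p q om : nat -> R) (n : nat) (y : R) : R :=
  Series (fun k => trig_term (p k) (q k) (om k) n y).

Lemma ex_series_dominated (u v : nat -> R) : (forall k, Rabs (u k) <= v k) ->
  ex_series v -> ex_series u.
Proof. intros Huv Hv. now apply (ex_series_le u v). Qed.

Lemma ex_series_mult_l (c : R) (u : nat -> R) : ex_series u -> ex_series (fun k => c * u k).
Proof. exact (ex_series_scal_l c u). Qed.

Lemma Series_bound (u v : nat -> R) : (forall k, Rabs (u k) <= v k) ->
  ex_series v -> Rabs (Series u) <= Series v.
Proof.
  intros Huv Hv.
  eapply Rle_trans; [apply Series_Rabs|].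
  - apply ex_series_dominated with v; auto. intros k. now rewrite Rabs_Rabsolu.
  - apply Series_le; auto. intros k. split; auto using Rabs_pos.
Qed.

(** [v n] majorises the derivatives of order [n] of all terms at once. [v (S (S n))] sums the second
    order errors and so gives differentiability, and [v n] itself gives the derivative bound. *)
Lemma trig_series_smooth (p q om b : nat -> R) rho : 0 < rho ->
  (forall k, Rabs (p k) <= b k) -> (forall k, Rabs (q k) <= b k) ->
  ex_series (fun k => b k * exp (rho * Rabs (om k))) ->
  deriv_seq (trig_series p q om) /\
  deriv_bound (2 * Series (fun k => b k * exp (rho * Rabs (om k)))) rho (trig_series p q om).
Proof.
  intros Hrho Hp Hq Hex.
  assert (Hb : forall k, 0 <= b k) by (intros k; eapply Rle_trans; [apply Rabs_pos|apply Hp]).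
  set (v := fun n k => 2 * (INR (fact n) / rho ^ n) * (b k * exp (rho * Rabs (om k)))).
  assert (Hv : forall n, ex_series (v n)) by (intros n; now apply ex_series_mult_l).
  assert (Hterm : forall n k y, Rabs (trig_term (p k) (q k) (om k) n y) <= v n k).
  { intros n k y. eapply Rle_trans; [apply trig_term_bound with (b := b k); auto|].
    unfold v. pose proof (pow_freq_bound (b k) (om k) rho n (Hb k) Hrho). lra. }
  assert (Hext : forall n y, ex_series (fun k => trig_term (p k) (q k) (om k) n y))
    by (intros n y; apply ex_series_dominated with (v n); auto).
  split.
  - intros n y. apply derivable_of_quadratic with (Series (v (S (S n)))).
    { eapply Rle_trans; [apply Rabs_pos|].
      now apply (Series_bound (fun k => trig_term (p k) (q k) (om k) (S (S n)) 0)). }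
    intros h. unfold trig_series.
    rewrite <- Series_scal_l, <- !Series_minus; auto.
    + rewrite Rmult_comm, <- Series_scal_l.
      apply Series_bound.
      * intros k. rewrite (Rmult_comm (h ^ 2)). apply second_order_bound; auto using trig_term_deriv.
      * now apply ex_series_mult_l.
    + now apply (ex_series_minus (fun k => trig_term (p k) (q k) (om k) n (y + h))
             (fun k => trig_term (p k) (q k) (om k) n y)).
    + now apply ex_series_mult_l.
  - intros n y. unfold trig_series.
    eapply Rle_trans; [apply (Series_bound _ (v n)); auto|].
    unfold v. rewrite Series_scal_l. right. field. pose proof (pow_lt rho n Hrho). lra.
Qed.

(** * The lower bound *)

Lemma Cx_ext z w : Cre z = Cre w -> Cim z = Cim w -> z = w.
Proof. destruct z, w. simpl. now intros -> ->. Qed.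

Lemma Cx_ring : ring_theory C0 C1 Cadd Cmul Csub Copp eq.
Proof.
  constructor; intros; try reflexivity; apply Cx_ext; simpl; ring.
Qed.

Add Ring Cx_ring_instance : Cx_ring.

Lemma Cmod_ge_0 z : 0 <= Cmod z.
Proof. apply sqrt_pos. Qed.

(** Modulus facts come from Coquelicot: both moduli unfold to the same real expression, so
    statements about pairs transfer by conversion. *)
Lemma Cmod_C0 : Cmod C0 = 0.
Proof. exact Complex.Cmod_0. Qed.

Lemma Cmod_eq_C0 z : Cmod z = 0 -> z = C0.
Proof.
  intros H. pose proof (Complex.Cmod_eq_0 (Cre z, Cim z) H) as E. injection E as E1 E2.
  now apply Cx_ext.
Qed.

Lemma Cmod_add z w : Cmod (Cadd z w) <= Cmod z + Cmod w.
Proof. exact (Complex.Cmod_triangle (Cre z, Cim z) (Cre w, Cim w)). Qed.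

Lemma Cmod_mul z w : Cmod (Cmul z w) = Cmod z * Cmod w.
Proof. exact (Complex.Cmod_mult (Cre z, Cim z) (Cre w, Cim w)). Qed.

Lemma Cmod_opp z : Cmod (Copp z) = Cmod z.
Proof. exact (Complex.Cmod_opp (Cre z, Cim z)). Qed.

Lemma Cmod_sub z w : Cmod (Csub z w) <= Cmod z + Cmod w.
Proof. unfold Csub. rewrite <- (Cmod_opp w). apply Cmod_add. Qed.

Lemma Cmod_RtoC x : Cmod (RtoC x) = Rabs x.
Proof. exact (Complex.Cmod_R x). Qed.

Lemma Cmod_Cexpi t : Cmod (Cexpi t) = 1.
Proof.
  unfold Cmod, Cexpi; simpl Cre; simpl Cim. rewrite <- sqrt_1. f_equal.
  rewrite <- !Rsqr_pow2, Rplus_comm. apply sin2_cos2.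
Qed.

Lemma Rabs_Cre_le z : Rabs (Cre z) <= Cmod z.
Proof.
  eapply Rle_trans; [|apply (Complex.Rmax_Cmod (Cre z, Cim z))]. apply Rmax_l.
Qed.

Lemma Rabs_Cim_le z : Rabs (Cim z) <= Cmod z.
Proof.
  eapply Rle_trans; [|apply (Complex.Rmax_Cmod (Cre z, Cim z))]. apply Rmax_r.
Qed.

Lemma Cmod_le_abs z : Cmod z <= Rabs (Cre z) + Rabs (Cim z).
Proof.
  replace z with (Cadd (RtoC (Cre z)) (Cmul (mkC 0 1) (RtoC (Cim z)))) at 1
    by (apply Cx_ext; simpl; ring).
  eapply Rle_trans; [apply Cmod_add|]. rewrite Cmod_mul, !Cmod_RtoC.
  replace (Cmod (mkC 0 1)) with 1; [lra|].
  unfold Cmod; simpl. replace (0 * (0 * 1) + 1 * (1 * 1)) with 1 by ring. now rewrite sqrt_1.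
Qed.

Lemma Cexpi_add s t : Cexpi (s + t) = Cmul (Cexpi s) (Cexpi t).
Proof.
  apply Cx_ext; simpl.
  - apply cos_plus.
  - rewrite sin_plus. ring.
Qed.

Lemma Cexpi_neq_1 t : t <> 0 -> Rabs t <= 1 -> Cexpi t <> C1.
Proof.
  intros Ht Ht1 E. apply (f_equal Cim) in E. simpl in E.
  pose proof PI2_3_2. apply Rabs_le_between in Ht1.
  destruct (Rtotal_order t 0) as [H'|[H'|H']]; [|lra|].
  - pose proof (sin_gt_0 (- t)) as Hs. rewrite sin_neg in Hs. lra.
  - pose proof (sin_gt_0 t) as Hs. lra.
Qed.

Lemma Csum_n_ext f g n : (forall k, (k < n)%nat -> f k = g k) -> Csum_n f n = Csum_n g n.
Proof.
  induction n as [|n IH]; intros H; simpl; auto. rewrite IH, H by auto. reflexivity.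
Qed.

Lemma Csum_n_add f g n :
  Csum_n (fun k => Cadd (f k) (g k)) n = Cadd (Csum_n f n) (Csum_n g n).
Proof. induction n as [|n IH]; simpl; [|rewrite IH]; ring. Qed.

Lemma Csum_n_mul c f n : Csum_n (fun k => Cmul c (f k)) n = Cmul c (Csum_n f n).
Proof. induction n as [|n IH]; simpl; [|rewrite IH]; ring. Qed.

Lemma Csum_n_zero f n : (forall k, (k < n)%nat -> f k = C0) -> Csum_n f n = C0.
Proof.
  induction n as [|n IH]; intros H; simpl; auto. rewrite IH, H by auto. ring.
Qed.

Lemma Csum_n_bound f n B : (forall k, (k < n)%nat -> Cmod (f k) <= B) ->
  Cmod (Csum_n f n) <= INR n * B.
Proof.
  induction n as [|n IH]; intros H.
  - simpl. rewrite Cmod_C0. lra.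
  - rewrite S_INR. simpl Csum_n. eapply Rle_trans; [apply Cmod_add|].
    rewrite Rmult_plus_distr_r, Rmult_1_l. apply Rplus_le_compat; auto.
Qed.

Lemma Csum_n_Cre f n : Cre (Csum_n f (S n)) = sum_f_R0 (fun k => Cre (f k)) n.
Proof. induction n as [|n IH]; [simpl; ring|]. simpl in *. now rewrite IH. Qed.

Lemma Csum_n_Cim f n : Cim (Csum_n f (S n)) = sum_f_R0 (fun k => Cim (f k)) n.
Proof. induction n as [|n IH]; [simpl; ring|]. simpl in *. now rewrite IH. Qed.

(** * Truncation of absolutely convergent series *)

Lemma Cseries_to_approx f l eps : Cseries_to f l -> 0 < eps ->
  exists K0, forall K, (K0 <= K)%nat -> Cmod (Csub l (Csum_n f K)) <= eps.
Proof.
  intros [Hre Him] Heps.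
  destruct (Hre (eps / 2)) as [K1 HK1]; [lra|].
  destruct (Him (eps / 2)) as [K2 HK2]; [lra|].
  exists (S (K1 + K2)). intros K HK. destruct K as [|n]; [lia|].
  specialize (HK1 n ltac:(lia)). specialize (HK2 n ltac:(lia)).
  eapply Rle_trans; [apply Cmod_le_abs|]. unfold Csub, Cadd, Copp.
  rewrite <- Csum_n_Cre in HK1. rewrite <- Csum_n_Cim in HK2. simpl Cre; simpl Cim.
  unfold Rdist in *. rewrite Rabs_minus_sym in HK1, HK2. unfold Rminus in *.
  simpl in *. lra.
Qed.

Definition dominated (c b : nat -> Cx) : Prop := forall k, Cmod (c k) <= Cmod (b k).

(** Quantified over all dominated sequences because one cut-off [K] must serve f at every point y,
    the series twisted by the character, and a subfamily of its terms. *)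
Definition tail_le (b : nat -> Cx) (K : nat) (eps : R) : Prop :=
  forall c, dominated c b -> forall K', (K <= K')%nat ->
    Cmod (Csub (Csum_n c K') (Csum_n c K)) <= eps.

Lemma exists_tail_le b eps : ex_series (fun k => Cmod (b k)) -> 0 < eps ->
  exists K0, forall K, (K0 <= K)%nat -> tail_le b K eps.
Proof.
  intros Hex Heps. set (s := fun k => RtoC (Cmod (b k))).
  destruct Hex as [l Hl]. apply is_series_Reals in Hl.
  assert (Hs : Cseries_to s (RtoC l)).
  { split; [exact Hl|]. intros e He. exists 0%nat. intros n _. simpl.
    unfold Rdist. rewrite sum_eq_R0 by auto. rewrite Rminus_0_r, Rabs_R0. exact He. }
  destruct (Cseries_to_approx s (RtoC l) (eps / 2) Hs ltac:(lra)) as [K0 HK0].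
  exists K0. intros K HK c Hc K' HK'.
  apply Rle_trans with (Cre (Csum_n s K') - Cre (Csum_n s K)).
  - clear - Hc HK'. induction HK' as [|K' HK' IH].
    + replace (Csub (Csum_n c K) (Csum_n c K)) with C0 by ring. rewrite Cmod_C0. lra.
    + simpl. replace (Csub (Cadd (Csum_n c K') (c K')) (Csum_n c K)) with
        (Cadd (Csub (Csum_n c K') (Csum_n c K)) (c K')) by ring.
      eapply Rle_trans; [apply Cmod_add|]. specialize (Hc K'). lra.
  - pose proof (HK0 K HK) as H1. pose proof (HK0 K' ltac:(lia)) as H2.
    pose proof (Rle_trans _ _ _ (Rabs_Cre_le _) H1) as H3.
    pose proof (Rle_trans _ _ _ (Rabs_Cre_le _) H2) as H4.
    apply Rabs_le_between in H3. apply Rabs_le_between in H4. simpl in *. lra.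
Qed.

Lemma tail_le_limit b K eps c l : tail_le b K eps -> dominated c b -> Cseries_to c l ->
  Cmod (Csub l (Csum_n c K)) <= eps.
Proof.
  intros Ht Hc Hl. apply le_epsilon. intros e He.
  destruct (Cseries_to_approx c l e Hl He) as [K0 HK0].
  specialize (HK0 (K0 + K)%nat ltac:(lia)). specialize (Ht c Hc (K0 + K)%nat ltac:(lia)).
  replace (Csub l (Csum_n c K)) with
    (Cadd (Csub (Csum_n c (K0 + K)) (Csum_n c K)) (Csub l (Csum_n c (K0 + K)))) by ring.
  eapply Rle_trans; [apply Cmod_add|]. lra.
Qed.

(** * Grouping terms by frequency *)

Definition freq_part (b : nat -> Cx) (om : nat -> R) (lam : R) (k : nat) : Cx :=
  if Req_dec_T (om k) lam then b k else C0.

(** Enumerates frequency classes through indices: those met by the first [i] terms number at most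
    [i], with no quotient to form. *)
Fixpoint seen (om : nat -> R) (i k : nat) : bool :=
  match i with
  | O => false
  | S j => if Req_dec_T (om j) (om k) then true else seen om j k
  end.

Lemma seen_spec om i k : seen om i k = true <-> exists j, (j < i)%nat /\ om j = om k.
Proof.
  induction i as [|i IH]; simpl.
  - split; [discriminate|]. intros [j [Hj _]]. lia.
  - destruct (Req_dec_T (om i) (om k)) as [E|E].
    + split; auto. intros _. exists i. auto.
    + rewrite IH. split; intros [j [Hj Ej]]; exists j.
      * auto.
      * destruct (Nat.eq_dec j i) as [->|]; [contradiction|]. split; auto. lia.
Qed.

(** Raising [i] by one adds nothing if the frequency [om i] was already seen, and otherwise exactly
    its class, on which [chi] is a constant of modulus 1; either way the cost is at most [s]. *)
Lemma seen_sum_bound b chi om K s :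
  (forall k, Cmod (chi k) = 1) -> (forall j k, om j = om k -> chi j = chi k) ->
  (forall lam, Cmod (Csum_n (freq_part b om lam) K) <= s) ->
  forall i, Cmod (Csum_n (fun k => if seen om i k then Cmul (b k) (chi k) else C0) K)
              <= INR i * s.
Proof.
  intros Hchi Hinv Hs. induction i as [|i IH].
  - rewrite Csum_n_zero; [|auto]. rewrite Cmod_C0. simpl. lra.
  - rewrite S_INR, Rmult_plus_distr_r, Rmult_1_l.
    assert (Hs0 : 0 <= s) by (eapply Rle_trans; [apply Cmod_ge_0|apply (Hs 0)]).
    destruct (seen om i i) eqn:Ei.
    + rewrite (Csum_n_ext _ (fun k => if seen om i k then Cmul (b k) (chi k) else C0)); [lra|].
      intros k _. simpl. destruct (Req_dec_T (om i) (om k)) as [E|E]; auto.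
      replace (seen om i k) with true; auto. symmetry.
      rewrite seen_spec in *. destruct Ei as [j [Hj Ej]]. exists j. split; congruence.
    + rewrite (Csum_n_ext _ (fun k => Cadd (if seen om i k then Cmul (b k) (chi k) else C0)
                                   (Cmul (chi i) (freq_part b om (om i) k)))).
      * rewrite Csum_n_add, Csum_n_mul. eapply Rle_trans; [apply Cmod_add|].
        rewrite Cmod_mul, Hchi, Rmult_1_l. specialize (Hs (om i)). lra.
      * intros k _. simpl. unfold freq_part.
        destruct (Req_dec_T (om i) (om k)) as [E|E];
        destruct (Req_dec_T (om k) (om i)) as [E'|E']; try congruence; [|ring].
        replace (seen om i k) with false.
        -- rewrite (Hinv i k E). ring.
        -- symmetry. apply Bool.not_true_is_false. intros H. rewrite seen_spec in H.
           destruct H as [j [Hj Ej]].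
           assert (seen om i i = true) by (apply seen_spec; exists j; split; congruence).
           congruence.
Qed.

(* If every frequency class had a tiny partial sum then, grouping by classes, so would the
   whole series twisted by the character [chi]. *)
Lemma exists_dominant_frequency b chi om l : ex_series (fun k => Cmod (b k)) ->
  (forall k, Cmod (chi k) = 1) -> (forall j k, om j = om k -> chi j = chi k) ->
  Cseries_to (fun k => Cmul (b k) (chi k)) l -> l <> C0 ->
  exists lam c K, 0 < c /\ tail_le b K c /\ 3 * c <= Cmod (Csum_n (freq_part b om lam) K).
Proof.
  intros Hex Hchi Hinv Hl Hl0. set (a := Cmod l).
  assert (Ha : 0 < a).
  { destruct (Cmod_ge_0 l) as [H|H]; auto. exfalso. apply Hl0. now apply Cmod_eq_C0. }
  assert (Hdom : dominated (fun k => Cmul (b k) (chi k)) b).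
  { intros k. rewrite Cmod_mul, Hchi. lra. }
  destruct (exists_tail_le b (a / 4) Hex ltac:(lra)) as [K1 HK1].
  (* The budget for |l| = a: a/4 for the tail beyond [K], less than a/4 for at most [K1] classes of
     size [s] each, and a/4 for the other classes; the total is below a. The final [c] is s/3. *)
  set (s := a / 4 / (INR K1 + 1)). pose proof (pos_INR K1) as HK1pos.
  assert (Hs : 0 < s) by (apply Rdiv_lt_0_compat; lra).
  destruct (exists_tail_le b (s / 3) Hex ltac:(lra)) as [K2 HK2].
  set (K := (K1 + K2)%nat).
  apply NNPP. intros Hno.
  assert (Hsmall : forall lam, Cmod (Csum_n (freq_part b om lam) K) <= s).
  { intros lam. apply Rnot_lt_le. intros H. apply Hno. exists lam, (s / 3), K.
    split; [lra|]. split; [apply HK2; unfold K; lia|]. lra. }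
  pose proof (seen_sum_bound b chi om K s Hchi Hinv Hsmall K1) as Hseen.
  pose proof (tail_le_limit b K (a / 4) _ l (HK1 K ltac:(unfold K; lia)) Hdom Hl) as Hlim.
  (* The terms in no class met before [K1]. Their first [K1] entries are 0, so their sum up to [K]
     is itself a tail. *)
  set (u := fun k => if seen om K1 k then C0 else Cmul (b k) (chi k)).
  assert (Hu : dominated u b).
  { intros k. unfold u. destruct (seen om K1 k); auto. rewrite Cmod_C0. apply Cmod_ge_0. }
  pose proof (HK1 K1 (Nat.le_refl _) u Hu K ltac:(unfold K; lia)) as Hutail.
  rewrite (Csum_n_zero u K1) in Hutail.
  2: { intros k Hk. unfold u. replace (seen om K1 k) with true; auto. symmetry.
       apply seen_spec. now exists k. }
  set (v := fun k => if seen om K1 k then Cmul (b k) (chi k) else C0) in *.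
  assert (Huv : Csum_n (fun k => Cmul (b k) (chi k)) K = Cadd (Csum_n v K) (Csum_n u K)).
  { rewrite <- Csum_n_add. apply Csum_n_ext. intros k _. unfold u, v.
    destruct (seen om K1 k); ring. }
  rewrite Huv in Hlim.
  assert (Htri : a <= a / 4 + (INR K1 * s + a / 4)).
  { unfold a at 1. replace l with (Cadd (Csub l (Cadd (Csum_n v K) (Csum_n u K)))
      (Cadd (Csum_n v K) (Csub (Csum_n u K) C0))) by ring.
    eapply Rle_trans; [apply Cmod_add|]. apply Rplus_le_compat; auto.
    eapply Rle_trans; [apply Cmod_add|]. apply Rplus_le_compat; auto. }
  assert (Hs1 : INR K1 * s + s = a / 4) by (unfold s; field; lra). lra.
Qed.

(** * Averages along arithmetic progressions *)

Lemma exponential_sum_telescopes th x h N :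
  Cmul (Csum_n (fun n => Cexpi (th * (x + INR n * h))) N) (Csub C1 (Cexpi (th * h))) =
  Csub (Cexpi (th * x)) (Cexpi (th * (x + INR N * h))).
Proof.
  induction N as [|N IH].
  - simpl. replace (th * (x + 0 * h)) with (th * x) by ring. ring.
  - rewrite S_INR. simpl Csum_n.
    replace (th * (x + (INR N + 1) * h)) with (th * (x + INR N * h) + th * h) by ring.
    rewrite Cexpi_add.
    match goal with |- Cmul (Cadd ?s ?e) ?w = _ =>
      replace (Cmul (Cadd s e) w) with (Cadd (Cmul s w) (Cmul e w)) by ring end.
    rewrite IH. ring.
Qed.

(** A geometric sum with ratio different from 1 is at most 2 / |1 - ratio|, whatever its length and
    starting point. The bound |th h| <= 1 < pi excludes resonance. *)
Lemma exponential_sum_bounded th h : Rabs (th * h) <= 1 -> th * h <> 0 ->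
  exists B, forall N x, Cmod (Csum_n (fun n => Cexpi (th * (x + INR n * h))) N) <= B.
Proof.
  intros Hle Hne. set (w := Csub C1 (Cexpi (th * h))).
  assert (Hw : 0 < Cmod w).
  { destruct (Cmod_ge_0 w) as [H|H]; auto. exfalso.
    apply (Cexpi_neq_1 (th * h) Hne Hle). symmetry in H. apply Cmod_eq_C0 in H.
    replace (Cexpi (th * h)) with (Csub C1 w) by (unfold w; ring). rewrite H. ring. }
  exists (2 / Cmod w). intros N x. apply (Rmult_le_reg_r (Cmod w)); auto.
  rewrite <- Cmod_mul. unfold w at 1. rewrite exponential_sum_telescopes.
  replace (2 / Cmod w * Cmod w) with (1 + 1) by (field; lra).
  eapply Rle_trans; [apply Cmod_sub|]. rewrite !Cmod_Cexpi. lra.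
Qed.

(** One sampling step must avoid resonance with all [K] frequency differences at once. *)
Lemma exists_small_step (om : nat -> R) lam K :
  exists h, 0 < h /\ forall k, (k < K)%nat -> Rabs ((om k - lam) * h) <= 1.
Proof.
  assert (Hbd : exists B, 0 < B /\ forall k, (k < K)%nat -> Rabs (om k - lam) <= B).
  { induction K as [|K [B [HB HK]]].
    - exists 1. split; [lra|]. intros; lia.
    - exists (B + Rabs (om K - lam)). pose proof (Rabs_pos (om K - lam)).
      split; [lra|]. intros k Hk. destruct (Nat.eq_dec k K) as [->|]; [lra|].
      specialize (HK k ltac:(lia)). lra. }
  destruct Hbd as [B [HB HK]]. exists (/ B). split; [now apply Rinv_0_lt_compat|].
  intros k Hk. rewrite Rabs_mult, (Rabs_right (/ B)) by (left; now apply Rinv_0_lt_compat).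
  apply (Rmult_le_reg_r B); auto. rewrite Rmult_assoc, Rinv_l by lra.
  specialize (HK k Hk). lra.
Qed.

(** Terms of frequency [lam] contribute their coefficient [N] times exactly; each other term gives a
    geometric sum bounded independently of [N] and [x]. The step [h] is fixed before the induction,
    as it must serve all terms. *)
Lemma mean_isolates_frequency b om lam K : exists h B, 0 < h /\ forall N x,
  Cmod (Csub (Csum_n (fun n => Csum_n (fun k =>
                Cmul (b k) (Cexpi ((om k - lam) * (x + INR n * h)))) K) N)
             (Cmul (RtoC (INR N)) (Csum_n (freq_part b om lam) K))) <= B.
Proof.
  destruct (exists_small_step om lam K) as [h [Hh HK]].
  exists h. induction K as [|K IH].
  - exists 0. split; auto. intros N x. rewrite Csum_n_zero by auto. simpl.
    replace (Csub C0 (Cmul (RtoC (INR N)) C0)) with C0 by ring. rewrite Cmod_C0. lra.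
  - destruct IH as [B [_ HB]]; [auto|].
    assert (HT : exists B', forall N x,
      Cmod (Csub (Csum_n (fun n => Cmul (b K) (Cexpi ((om K - lam) * (x + INR n * h)))) N)
                 (Cmul (RtoC (INR N)) (freq_part b om lam K))) <= B').
    { unfold freq_part. destruct (Req_dec_T (om K) lam) as [E|E].
      - exists 0. intros N x.
        match goal with |- Cmod ?z <= 0 => replace z with C0; [rewrite Cmod_C0; lra|] end.
        rewrite (Csum_n_ext _ (fun _ => b K)).
        + induction N as [|N IHN]; [apply Cx_ext; simpl; ring|].
          rewrite S_INR. simpl Csum_n. rewrite IHN.
          apply Cx_ext; simpl; ring.
        + intros n _. rewrite E. replace ((lam - lam) * (x + INR n * h)) with 0 by ring.
          apply Cx_ext; simpl; rewrite cos_0, sin_0; ring.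
      - destruct (exponential_sum_bounded (om K - lam) h) as [B' HB'].
        + apply HK. lia.
        + apply Rmult_integral_contrapositive_currified; lra.
        + exists (Cmod (b K) * B'). intros N x. rewrite Csum_n_mul.
          match goal with |- Cmod (Csub ?z ?w) <= _ => replace (Csub z w) with z by ring end.
          rewrite Cmod_mul. apply Rmult_le_compat_l; [apply Cmod_ge_0|apply HB']. }
    destruct HT as [B' HB']. exists (B + B'). split; auto. intros N x. simpl Csum_n.
    rewrite Csum_n_add.
    match goal with |- Cmod (Csub (Cadd ?u ?v) (Cmul ?n (Cadd ?p ?q))) <= _ =>
      replace (Csub (Cadd u v) (Cmul n (Cadd p q))) with
        (Cadd (Csub u (Cmul n p)) (Csub v (Cmul n q))) by ring end.
    eapply Rle_trans; [apply Cmod_add|]. apply Rplus_le_compat; auto.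
Qed.

(** Here the factor 3 of [exists_dominant_frequency] is spent. If |f| <= c at all [N] sample points,
    each truncated sum is at most 2c (c for f, c for the tail), so 3Nc <= B + 2Nc, against the
    choice of [N] with B < Nc. *)
Lemma almost_periodic_lower_bound b chi om l f : ex_series (fun k => Cmod (b k)) ->
  (forall k, Cmod (chi k) = 1) -> (forall j k, om j = om k -> chi j = chi k) ->
  Cseries_to (fun k => Cmul (b k) (chi k)) l -> l <> C0 ->
  (forall y, Cseries_to (fun k => Cmul (b k) (Cexpi (om k * y))) (f y)) ->
  exists c T, 0 < c /\ forall x, exists y, x <= y <= x + T /\ c <= Cmod (f y).
Proof.
  intros Hex Hchi Hinv Hl Hl0 Hf.
  destruct (exists_dominant_frequency b chi om l Hex Hchi Hinv Hl Hl0)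
    as [lam [c [K [Hc [Htail Hdom]]]]].
  destruct (mean_isolates_frequency b om lam K) as [h [B [Hh HB]]].
  destruct (INR_unbounded (B / c)) as [N HN].
  assert (HNc : B < INR N * c).
  { apply (Rmult_lt_compat_r c) in HN; auto.
    replace (B / c * c) with B in HN by (field; lra). lra. }
  exists c, (INR N * h). split; auto. intros x. apply NNPP. intros Hno.
  assert (Hsm : forall n, (n < N)%nat -> Cmod (f (x + INR n * h)) <= c).
  { intros n Hn. apply Rnot_lt_le. intros H. apply Hno. exists (x + INR n * h).
    pose proof (pos_INR n). apply lt_INR in Hn.
    assert (0 <= INR n * h) by (apply Rmult_le_pos; lra).
    assert (INR n * h <= INR N * h) by (apply Rmult_le_compat_r; lra). lra. }
  specialize (HB N x).
  match type of HB with Cmod (Csub ?z (Cmul ?n ?w)) <= _ =>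
    assert (Hz : Cmod z <= INR N * (c + c));
    [|assert (Hw : Cmod (Cmul n w) <= B + INR N * (c + c));
      [replace (Cmul n w) with (Cadd (Copp (Csub z (Cmul n w))) z) by ring;
       eapply Rle_trans; [apply Cmod_add|]; rewrite Cmod_opp; lra|]] end.
  - apply Csum_n_bound. intros n Hn. set (y := x + INR n * h) in *.
    rewrite (Csum_n_ext _ (fun k => Cmul (Cexpi (- (lam * y))) (Cmul (b k) (Cexpi (om k * y))))).
    + rewrite Csum_n_mul, Cmod_mul, Cmod_Cexpi, Rmult_1_l.
      match goal with |- Cmod ?s <= _ =>
        replace s with (Csub (f y) (Csub (f y) s)) by ring end.
      eapply Rle_trans; [apply Cmod_sub|]. apply Rplus_le_compat; [now apply Hsm|].
      apply (tail_le_limit b K c (fun k => Cmul (b k) (Cexpi (om k * y)))); auto.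
      intros k. rewrite Cmod_mul, Cmod_Cexpi. lra.
    + intros k _. replace ((om k - lam) * y) with (- (lam * y) + om k * y) by ring.
      rewrite Cexpi_add. ring.
  - rewrite Cmod_mul, Cmod_RtoC, Rabs_right in Hw by (apply Rle_ge, pos_INR).
    pose proof (Rmult_le_compat_l (INR N) _ _ (pos_INR N) Hdom). lra.
Qed.

(** * Integer relations between powers of alpha *)

Fixpoint Rsum_n (f : nat -> R) (n : nat) : R :=
  match n with O => 0 | S m => Rsum_n f m + f m end.

Lemma Rsum_n_ext f g n : (forall k, (k < n)%nat -> f k = g k) -> Rsum_n f n = Rsum_n g n.
Proof.
  induction n as [|n IH]; intros H; simpl; auto. rewrite IH, H by auto. reflexivity.
Qed.

Lemma Rsum_n_zero f n : (forall k, (k < n)%nat -> f k = 0) -> Rsum_n f n = 0.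
Proof.
  induction n as [|n IH]; intros H; simpl; auto. rewrite IH, H by auto. ring.
Qed.

Lemma Rsum_n_add f g n : Rsum_n (fun k => f k + g k) n = Rsum_n f n + Rsum_n g n.
Proof. induction n as [|n IH]; simpl; [|rewrite IH]; ring. Qed.

Lemma Rsum_n_sub f g n : Rsum_n (fun k => f k - g k) n = Rsum_n f n - Rsum_n g n.
Proof. induction n as [|n IH]; simpl; [|rewrite IH]; ring. Qed.

Lemma Rsum_n_mul c f n : Rsum_n (fun k => c * f k) n = c * Rsum_n f n.
Proof. induction n as [|n IH]; simpl; [|rewrite IH]; ring. Qed.

Lemma Rsum_n_last f n : Rsum_n f (S n) = Rsum_n f n + f n.
Proof. reflexivity. Qed.

Lemma Rsum_n_first f n : Rsum_n f (S n) = f 0%nat + Rsum_n (fun k => f (S k)) n.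
Proof. induction n as [|n IH]; [simpl; ring|]. simpl in *. rewrite IH. ring. Qed.

Lemma Csum_n_first f n : Csum_n f (S n) = Cadd (f 0%nat) (Csum_n (fun k => f (S k)) n).
Proof. induction n as [|n IH]; [simpl; ring|]. simpl in *. rewrite IH. ring. Qed.

Lemma evalZ_R_sum p x :
  evalZ_R p x = Rsum_n (fun i => IZR (nth i p 0%Z) * x ^ i) (length p).
Proof.
  induction p as [|c p IH]; auto.
  change (length (c :: p)) with (S (length p)). rewrite Rsum_n_first. simpl.
  rewrite IH, <- Rsum_n_mul, Rmult_1_r. f_equal. apply Rsum_n_ext. intros; ring.
Qed.

Lemma evalQ_R_sum p x :
  evalQ_R p x = Rsum_n (fun i => Q2R (nth i p 0%Q) * x ^ i) (length p).
Proof.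
  induction p as [|c p IH]; auto.
  change (length (c :: p)) with (S (length p)). rewrite Rsum_n_first. simpl.
  rewrite IH, <- Rsum_n_mul, Rmult_1_r. f_equal. apply Rsum_n_ext. intros; ring.
Qed.

Lemma evalZ_C_sum p z :
  evalZ_C p z = Csum_n (fun i => Cmul (RtoC (IZR (nth i p 0%Z))) (Cpow z i)) (length p).
Proof.
  induction p as [|c p IH]; auto.
  change (length (c :: p)) with (S (length p)). rewrite Csum_n_first. simpl.
  rewrite IH, <- Csum_n_mul. f_equal; [ring|]. apply Csum_n_ext. intros; ring.
Qed.

Lemma Q2R_inject_Z z : Q2R (inject_Z z) = IZR z.
Proof. unfold Q2R. simpl. field. Qed.

Definition no_short_relation (alpha : R) (d : nat) : Prop :=
  forall (p : nat -> Z) n, (n <= d)%nat -> Rsum_n (fun i => IZR (p i) * alpha ^ i) n = 0 ->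
    forall i, (i < n)%nat -> p i = 0%Z.

Lemma alg_degree_no_short_relation alpha d : alg_degree alpha d -> no_short_relation alpha d.
Proof.
  intros [_ H] p n Hn Hsum i Hi.
  set (q := map (fun i => inject_Z (p i)) (seq 0 n)).
  assert (Hlen : length q = n) by (unfold q; now rewrite length_map, length_seq).
  assert (Hnth : forall k, (k < n)%nat -> Q2R (nth k q 0%Q) = IZR (p k)).
  { intros k Hk. unfold q.
    rewrite (nth_indep _ 0%Q (inject_Z (p 0%nat))) by (rewrite length_map, length_seq; auto).
    rewrite (map_nth (fun i => inject_Z (p i))), seq_nth by auto. apply Q2R_inject_Z. }
  apply eq_IZR. rewrite <- Hnth by auto.
  apply (H q); [lia| |apply nth_In; lia].
  rewrite evalQ_R_sum, Hlen, <- Hsum. apply Rsum_n_ext. intros k Hk. now rewrite Hnth.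
Qed.

Definition is_int (x : R) : Prop := exists n : Z, x = IZR n.

Lemma is_int_add x y : is_int x -> is_int y -> is_int (x + y).
Proof. intros [n ->] [m ->]. exists (n + m)%Z. now rewrite plus_IZR. Qed.

Lemma is_int_mul c x : is_int x -> is_int (IZR c * x).
Proof. intros [n ->]. exists (c * n)%Z. now rewrite mult_IZR. Qed.

(** The coefficients on the left are those of x^j P(x), paired with an arbitrary sequence instead of
    powers. *)
Lemma shifted_coef_sum (P : nat -> Z) (y : nat -> R) j n :
  Rsum_n (fun i => IZR (if (j <=? i)%nat then P (i - j)%nat else 0%Z) * y i) (j + n) =
  Rsum_n (fun l => IZR (P l) * y (j + l)%nat) n.
Proof.
  induction n as [|n IH].
  - rewrite Nat.add_0_r. simpl Rsum_n at 2. apply Rsum_n_zero. intros k Hk.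
    destruct (Nat.leb_spec j k); [lia|]. ring.
  - rewrite <- plus_n_Sm. simpl Rsum_n. rewrite IH. f_equal.
    destruct (Nat.leb_spec j (j + n)); [|lia]. do 3 f_equal. lia.
Qed.

(* Dividing by the monic minimal polynomial [P]: a relation satisfied by the powers of [alpha]
   is an integer combination of shifts of [P]. *)
Lemma relation_is_int alpha d (P : nat -> Z) (x : nat -> R) :
  no_short_relation alpha d -> P d = 1%Z ->
  Rsum_n (fun l => IZR (P l) * alpha ^ l) (S d) = 0 ->
  (forall i, is_int (Rsum_n (fun l => IZR (P l) * x (i + l)%nat) (S d))) ->
  forall n (p : nat -> Z), Rsum_n (fun i => IZR (p i) * alpha ^ i) n = 0 ->
    is_int (Rsum_n (fun i => IZR (p i) * x i) n).
Proof.
  intros Hmin HPd HP Hx n. induction n as [|m IH]; intros p Hp.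
  - now exists 0%Z.
  - destruct (Nat.le_gt_cases (S m) d) as [Hle|Hgt].
    + exists 0%Z. apply Rsum_n_zero. intros i Hi. rewrite (Hmin p (S m) Hle Hp i Hi). ring.
    + set (j := (m - d)%nat).
      set (p' := fun i => (p i - p m * (if (j <=? i)%nat then P (i - j)%nat else 0))%Z).
      (* One step of division: [P] being monic, subtracting p(m) x^j P removes the leading
         coefficient and stays in integers. It is stated for every [y] because it is used for the
         powers of [alpha] and for [x]. *)
      assert (Hred : forall y : nat -> R, Rsum_n (fun i => IZR (p i) * y i) (S m) =
        Rsum_n (fun i => IZR (p' i) * y i) m +
        IZR (p m) * Rsum_n (fun l => IZR (P l) * y (j + l)%nat) (S d)).
      { intros y. rewrite <- shifted_coef_sum. replace (j + S d)%nat with (S m) by (unfold j; lia).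
        rewrite <- Rsum_n_mul.
        assert (Hm : p' m = 0%Z).
        { unfold p'. destruct (Nat.leb_spec j m); [|unfold j in *; lia].
          replace (m - j)%nat with d by (unfold j; lia). rewrite HPd. ring. }
        replace (Rsum_n (fun i => IZR (p' i) * y i) m) with
          (Rsum_n (fun i => IZR (p' i) * y i) (S m)) by (simpl; rewrite Hm; ring).
        rewrite <- Rsum_n_add. apply Rsum_n_ext. intros i _. unfold p'.
        rewrite minus_IZR, mult_IZR. ring. }
      rewrite Hred. apply is_int_add; [|now apply is_int_mul].
      apply IH. rewrite Hred in Hp.
      replace (Rsum_n (fun l => IZR (P l) * alpha ^ (j + l)) (S d)) with 0 in Hp; [lra|].
      rewrite (Rsum_n_ext _ (fun l => alpha ^ j * (IZR (P l) * alpha ^ l))).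
      * rewrite Rsum_n_mul, HP. ring.
      * intros l _. rewrite pow_add. ring.
Qed.

(** Integers within 1/4 of [x] coincide, so one integer serves every precision. *)
Lemma is_int_of_approx x : (forall e, 0 < e -> exists n : Z, Rabs (x - IZR n) <= e) -> is_int x.
Proof.
  intros H. destruct (H (1 / 4)) as [n Hn]; [lra|]. exists n.
  apply Rminus_diag_uniq. apply NNPP. intros Hne.
  pose proof (Rabs_pos_lt _ Hne) as Hpos.
  destruct (H (Rmin (1 / 4) (Rabs (x - IZR n) / 2))) as [m Hm].
  { apply Rmin_glb_lt; lra. }
  pose proof (Rle_trans _ _ _ Hm (Rmin_l _ _)) as Hm1.
  pose proof (Rle_trans _ _ _ Hm (Rmin_r _ _)) as Hm2.
  assert (Hnm : n = m).
  { apply Rabs_le_between in Hn. apply Rabs_le_between in Hm1.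
    assert (-1 < n - m)%Z by (apply lt_IZR; rewrite minus_IZR; lra).
    assert (n - m < 1)%Z by (apply lt_IZR; rewrite minus_IZR; lra). lia. }
  subst m. lra.
Qed.

(** Integer coefficients turn the unknown integer shifts of the coordinates into a single integer
    shift. *)
Lemma T_close_combination (P : nat -> Z) (u v : nat -> R) eps n :
  (forall l, (l < n)%nat -> T_close (u l) (v l) eps) ->
  exists N : Z, Rabs (Rsum_n (fun l => IZR (P l) * u l) n
                       - Rsum_n (fun l => IZR (P l) * v l) n - IZR N)
                <= Rsum_n (fun l => Rabs (IZR (P l))) n * eps.
Proof.
  induction n as [|n IH]; intros H.
  - exists 0%Z. simpl. rewrite !Rminus_0_r, Rabs_R0. lra.
  - destruct IH as [N HN]; [auto|]. destruct (H n) as [m Hm]; [lia|].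
    exists (N + P n * m)%Z. simpl. rewrite plus_IZR, mult_IZR.
    replace (Rsum_n (fun l => IZR (P l) * u l) n + IZR (P n) * u n -
      (Rsum_n (fun l => IZR (P l) * v l) n + IZR (P n) * v n) - (IZR N + IZR (P n) * IZR m))
    with ((Rsum_n (fun l => IZR (P l) * u l) n - Rsum_n (fun l => IZR (P l) * v l) n - IZR N)
      + IZR (P n) * (u n - v n - IZR m)) by ring.
    eapply Rle_trans; [apply Rabs_triang|]. rewrite Rmult_plus_distr_r, Rabs_mult.
    apply Rplus_le_compat; auto. apply Rmult_le_compat_l; [apply Rabs_pos|lra].
Qed.

(** * Integer powers of the conjugates and the recurrence on G *)

Lemma Cmul_neq_0 z w : z <> C0 -> w <> C0 -> Cmul z w <> C0.
Proof.
  intros Hz Hw E. apply (f_equal Cmod) in E. rewrite Cmod_mul, Cmod_C0 in E.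
  apply Rmult_integral in E. destruct E as [E|E]; apply Cmod_eq_C0 in E; auto.
Qed.

Lemma Cinv_l z : z <> C0 -> Cmul (Cinv z) z = C1.
Proof.
  intros Hz. assert (H : Cre z ^ 2 + Cim z ^ 2 <> 0).
  { intros E. apply Hz. apply Cmod_eq_C0. unfold Cmod. rewrite E. apply sqrt_0. }
  apply Cx_ext; simpl Cre; simpl Cim; field; intros E; apply H; rewrite <- E; ring.
Qed.

Lemma Cinv_mul_cancel z w : z <> C0 -> w <> C0 -> Cmul (Cinv (Cmul w z)) z = Cinv w.
Proof.
  intros Hz Hw.
  replace (Cmul (Cinv (Cmul w z)) z) with
    (Cmul (Cmul (Cinv (Cmul w z)) z) (Cmul (Cinv w) w)) by (rewrite (Cinv_l w) by auto; ring).
  replace (Cmul (Cmul (Cinv (Cmul w z)) z) (Cmul (Cinv w) w)) with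
    (Cmul (Cmul (Cinv (Cmul w z)) (Cmul w z)) (Cinv w)) by ring.
  rewrite Cinv_l by now apply Cmul_neq_0. ring.
Qed.

Lemma Cpow_neq_0 z n : z <> C0 -> Cpow z n <> C0.
Proof.
  intros Hz. induction n as [|n IH]; simpl.
  - intros E. injection E. lra.
  - now apply Cmul_neq_0.
Qed.

Lemma CpowZ_of_nat z n : CpowZ z (Z.of_nat n) = Cpow z n.
Proof. destruct n as [|n]; auto. simpl CpowZ. now rewrite SuccNat2Pos.id_succ. Qed.

Lemma CpowZ_opp_of_nat z n : CpowZ z (- Z.of_nat n) = Cinv (Cpow z n).
Proof.
  destruct n as [|n].
  - apply Cx_ext; simpl; field.
  - simpl CpowZ. now rewrite SuccNat2Pos.id_succ.
Qed.

Lemma CpowZ_succ z j : z <> C0 -> CpowZ z (j + 1) = Cmul (CpowZ z j) z.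
Proof.
  intros Hz. destruct (Z_lt_le_dec j 0) as [Hj|Hj].
  - set (n := Z.to_nat (- j - 1)).
    replace (j + 1)%Z with (- Z.of_nat n)%Z by (unfold n; lia).
    replace j with (- Z.of_nat (S n))%Z by (unfold n; lia).
    rewrite !CpowZ_opp_of_nat. simpl Cpow.
    replace (Cmul z (Cpow z n)) with (Cmul (Cpow z n) z) by ring.
    symmetry. apply Cinv_mul_cancel; auto. now apply Cpow_neq_0.
  - set (n := Z.to_nat j).
    replace (j + 1)%Z with (Z.of_nat (S n)) by (unfold n; lia).
    replace j with (Z.of_nat n) by (unfold n; lia).
    rewrite !CpowZ_of_nat. simpl. ring.
Qed.

Lemma CpowZ_add z j l : z <> C0 -> CpowZ z (j + Z.of_nat l) = Cmul (CpowZ z j) (Cpow z l).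
Proof.
  intros Hz. induction l as [|l IH].
  - rewrite Z.add_0_r. simpl. ring.
  - replace (j + Z.of_nat (S l))%Z with (j + Z.of_nat l + 1)%Z by lia.
    rewrite CpowZ_succ, IH by auto. simpl. ring.
Qed.

Lemma Cre_Csum_n_RtoC (c : nat -> R) (f : nat -> Cx) n :
  Rsum_n (fun l => c l * Cre (f l)) n = Cre (Csum_n (fun l => Cmul (RtoC (c l)) (f l)) n).
Proof. induction n as [|n IH]; simpl; auto. rewrite IH. ring. Qed.

Lemma vartheta_recurrence d conjs s (P : nat -> Z) j :
  (forall k, (k < d)%nat -> conjs k <> C0) ->
  (forall k, (k < d)%nat ->
     Csum_n (fun l => Cmul (RtoC (IZR (P l))) (Cpow (conjs k) l)) (S d) = C0) ->
  Rsum_n (fun l => IZR (P l) * vartheta d conjs s (j + Z.of_nat l)) (S d) = 0.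
Proof.
  intros Hne Hroot. unfold vartheta.
  (* Interchange of the sums over coefficients and over conjugates; separate lengths [m] and [n]
     permit induction on the number of conjugates alone. *)
  enough (H : forall m n, (n <= d)%nat ->
    Rsum_n (fun l => IZR (P l) *
      Cre (Csum_n (fun k => Cmul (s k) (CpowZ (conjs k) (j + Z.of_nat l))) n)) m =
    Cre (Csum_n (fun k => Cmul (Cmul (s k) (CpowZ (conjs k) j))
      (Csum_n (fun l => Cmul (RtoC (IZR (P l))) (Cpow (conjs k) l)) m)) n)).
  { rewrite H by auto. rewrite Csum_n_zero; [reflexivity|].
    intros k Hk. rewrite Hroot by auto. ring. }
  intros m n Hn. induction n as [|n IH].
  - apply Rsum_n_zero. intros. simpl. ring.
  - simpl Csum_n. rewrite (Rsum_n_ext _ (fun l => IZR (P l) *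
      Cre (Csum_n (fun k => Cmul (s k) (CpowZ (conjs k) (j + Z.of_nat l))) n) +
      IZR (P l) * Cre (Cmul (s n) (CpowZ (conjs n) (j + Z.of_nat l))))).
    2: { intros l _. change (Cre (Cadd ?x ?y)) with (Cre x + Cre y). simpl. ring. }
    rewrite Rsum_n_add, IH by lia.
    change (Cre (Cadd ?x ?y)) with (Cre x + Cre y). f_equal.
    rewrite Cre_Csum_n_RtoC, <- Csum_n_mul. f_equal. apply Csum_n_ext. intros l _.
    rewrite CpowZ_add by (apply Hne; lia). ring.
Qed.

Lemma Cprod_n_zero f n k : (k < n)%nat -> f k = C0 -> Cprod_n f n = C0.
Proof.
  induction n as [|n IH]; intros Hk Hf; [lia|]. simpl.
  destruct (Nat.eq_dec k n) as [->|Hne].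
  - rewrite Hf. ring.
  - rewrite IH by (auto; lia). ring.
Qed.

Lemma alpha_neq_0 alpha d : (2 <= d)%nat -> no_short_relation alpha d -> alpha <> 0.
Proof.
  intros Hd Hmin E.
  (* The coefficients 0, 1 encode the relation alpha = 0, of length 2 <= d. *)
  assert (H : (fun i : nat => Z.of_nat i) 1%nat = 0%Z); [|discriminate].
  apply (Hmin (fun i => Z.of_nat i) 2%nat Hd); [|lia]. simpl. rewrite E. ring.
Qed.

(** A zero conjugate forces P(0) = 0; dividing P(alpha) = 0 by alpha leaves a relation of length d
    with leading coefficient 1. Negative powers of the conjugates need this. *)
Lemma conjs_neq_0 alpha d conjs (P : list Z) : (2 <= d)%nat ->
  no_short_relation alpha d -> monic_Z_deg P d -> evalZ_R P alpha = 0 ->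
  (forall z, evalZ_C P z = Cprod_n (fun k => Csub z (conjs k)) d) ->
  forall k, (k < d)%nat -> conjs k <> C0.
Proof.
  intros Hd Hmin [Hlen Hlead] Hroot Hfac k Hk E.
  pose proof (alpha_neq_0 alpha d Hd Hmin) as Ha.
  assert (HP0 : nth 0 P 0%Z = 0%Z).
  { specialize (Hfac C0). rewrite (Cprod_n_zero _ d k Hk) in Hfac by (rewrite E; ring).
    destruct P as [|c P]; [discriminate|]. simpl in *.
    apply (f_equal Cre) in Hfac. simpl in Hfac. apply eq_IZR. lra. }
  rewrite evalZ_R_sum, Hlen, Rsum_n_first, HP0 in Hroot.
  rewrite (Rsum_n_ext _ (fun i => alpha * (IZR (nth (S i) P 0%Z) * alpha ^ i))) in Hroot
    by (intros; simpl; ring).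
  rewrite Rsum_n_mul in Hroot.
  assert (Hsum : Rsum_n (fun i => IZR (nth (S i) P 0%Z) * alpha ^ i) d = 0).
  { apply (Rmult_eq_reg_l alpha); auto. lra. }
  pose proof (Hmin (fun i => nth (S i) P 0%Z) d (Nat.le_refl _) Hsum (d - 1)%nat ltac:(lia)) as H.
  cbv beta in H. replace (S (d - 1)) with d in H by lia. congruence.
Qed.

(** The recurrence holds exactly on the image of S and, modulo 1, is a closed condition on d + 1
    coordinates; hence it passes to the closure. *)
Lemma in_G_recurrence d conjs g (P : nat -> Z) :
  (forall k, (k < d)%nat -> conjs k <> C0) ->
  (forall k, (k < d)%nat ->
     Csum_n (fun l => Cmul (RtoC (IZR (P l))) (Cpow (conjs k) l)) (S d) = C0) ->
  in_G d conjs g ->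
  forall j, is_int (Rsum_n (fun l => IZR (P l) * g (j + Z.of_nat l)%Z) (S d)).
Proof.
  intros Hne Hroot HG j. apply is_int_of_approx. intros e He.
  set (B := Rsum_n (fun l => Rabs (IZR (P l))) (S d)).
  assert (HB : 0 <= B).
  { unfold B. clear. induction (S d) as [|n IH]; simpl; [lra|].
    pose proof (Rabs_pos (IZR (P n))). lra. }
  assert (Heps : 0 < e / (B + 1)) by (apply Rdiv_lt_0_compat; lra).
  destruct (HG (map (fun l => (j + Z.of_nat l)%Z) (seq 0 (S d))) (e / (B + 1)) Heps)
    as [s [_ Hs]].
  destruct (T_close_combination P (fun l => vartheta d conjs s (j + Z.of_nat l))
    (fun l => g (j + Z.of_nat l)%Z) (e / (B + 1)) (S d)) as [N HN].
  { intros l Hl. apply Hs. apply in_map_iff. exists l. split; auto. apply in_seq. lia. }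
  rewrite vartheta_recurrence in HN by auto. fold B in HN.
  exists (- N)%Z. rewrite opp_IZR, <- Rabs_Ropp.
  match type of HN with Rabs ?u <= _ => match goal with |- Rabs ?w <= _ =>
    replace w with u by ring end end.
  eapply Rle_trans; [exact HN|].
  apply (Rmult_le_reg_r (B + 1)); [lra|].
  replace (B * (e / (B + 1)) * (B + 1)) with (B * e) by (field; lra). lra.
Qed.

(** * Laurent relations and the character *)

Lemma sumZ_sym_Rsum N f :
  sumZ_sym N f = Rsum_n (fun i => f (Z.of_nat i - Z.of_nat N)%Z) (2 * N + 1).
Proof.
  unfold sumZ_sym. set (h := fun n => f (Z.of_nat n - Z.of_nat N)%Z).
  assert (H : forall n s, fold_right Rplus 0 (map h (seq s n)) = Rsum_n (fun i => h (s + i)%nat) n).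
  { induction n as [|n IH]; intros s; auto. rewrite Rsum_n_first. simpl.
    rewrite IH, Nat.add_0_r. f_equal. apply Rsum_n_ext. intros i _. f_equal. lia. }
  apply H.
Qed.

Lemma sumZ_sym_extend N f m : (forall j, (Z.abs j > Z.of_nat N)%Z -> f j = 0) ->
  sumZ_sym (N + m) f = sumZ_sym N f.
Proof.
  intros Hf. induction m as [|m IH]; [now rewrite Nat.add_0_r|].
  rewrite <- IH, !sumZ_sym_Rsum.
  replace (2 * (N + S m) + 1)%nat with (S (S (2 * (N + m) + 1))) by lia.
  rewrite Rsum_n_first, Rsum_n_last. rewrite !Hf by lia.
  rewrite Rplus_0_l, Rplus_0_r. apply Rsum_n_ext. intros i _. f_equal. lia.
Qed.

Lemma Cexpi_2PI_Z n : Cexpi (2 * PI * IZR n) = C1.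
Proof.
  assert (H : forall k, Cexpi (2 * PI * INR k) = C1).
  { intros k. apply Cx_ext; simpl; replace (2 * PI * INR k) with (0 + 2 * INR k * PI) by ring.
    - rewrite cos_period. apply cos_0.
    - rewrite sin_period. apply sin_0. }
  destruct (Z_le_gt_dec 0 n) as [Hn|Hn].
  - rewrite <- (Z2Nat.id n Hn), <- INR_IZR_INZ. apply H.
  - assert (E : Cexpi (2 * PI * IZR (- n)) = C1).
    { rewrite <- (Z2Nat.id (- n)), <- INR_IZR_INZ by lia. apply H. }
    rewrite opp_IZR in E.
    assert (E0 : Cexpi (2 * PI * IZR n + 2 * PI * - IZR n) = C1).
    { replace (2 * PI * IZR n + 2 * PI * - IZR n) with 0 by ring.
      apply Cx_ext; simpl; [apply cos_0|apply sin_0]. }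
    rewrite Cexpi_add, E in E0. rewrite <- E0. ring.
Qed.

(* [m] is the coefficient function of an element of [Z[x, 1/x]] vanishing at [alpha]. *)
Lemma laurent_relation_is_int alpha d conjs g (m : Z -> Z) N : (2 <= d)%nat ->
  PV_with_conjugates alpha d conjs -> in_G d conjs g ->
  sumZ_sym N (fun j => IZR (m j) * powerRZ alpha j) = 0 ->
  is_int (sumZ_sym N (fun j => IZR (m j) * g j)).
Proof.
  intros Hd [Hdeg [[P [HP [Hroot Hfac]]] _]] HG Hm.
  pose proof (alg_degree_no_short_relation alpha d Hdeg) as Hmin.
  pose proof (alpha_neq_0 alpha d Hd Hmin) as Ha.
  pose proof (conjs_neq_0 alpha d conjs P Hd Hmin HP Hroot Hfac) as Hne.
  destruct HP as [Hlen Hlead].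
  rewrite evalZ_R_sum, Hlen in Hroot.
  assert (HC : forall k, (k < d)%nat ->
    Csum_n (fun l => Cmul (RtoC (IZR (nth l P 0%Z))) (Cpow (conjs k) l)) (S d) = C0).
  { intros k Hk. rewrite <- Hlen, <- evalZ_C_sum, Hfac. apply (Cprod_n_zero _ d k Hk). ring. }
  pose proof (in_G_recurrence d conjs g (fun l => nth l P 0%Z) Hne HC HG) as Hrec.
  rewrite sumZ_sym_Rsum in Hm |- *.
  apply (relation_is_int alpha d (fun l => nth l P 0%Z)
    (fun i => g (Z.of_nat i - Z.of_nat N)%Z) Hmin Hlead Hroot).
  - intros i. specialize (Hrec (Z.of_nat i - Z.of_nat N)%Z).
    erewrite Rsum_n_ext; [exact Hrec|]. intros l _. cbv beta. do 2 f_equal. lia.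
  (* Multiplying by alpha^N turns the Laurent relation into a polynomial one. *)
  - cbv beta. rewrite (Rsum_n_ext _ (fun i => alpha ^ N *
      (IZR (m (Z.of_nat i - Z.of_nat N)%Z) * powerRZ alpha (Z.of_nat i - Z.of_nat N)))).
    + rewrite Rsum_n_mul, Hm. ring.
    + intros i _. unfold Z.sub. rewrite powerRZ_add, powerRZ_neg' by auto.
      rewrite <- !pow_powerRZ. field. now apply pow_nonzero.
Qed.

Lemma character_depends_on_value alpha d conjs g (t1 t2 : Z -> Z) N1 N2 : (2 <= d)%nat ->
  PV_with_conjugates alpha d conjs -> in_G d conjs g ->
  (forall j, (Z.abs j > Z.of_nat N1)%Z -> t1 j = 0%Z) ->
  (forall j, (Z.abs j > Z.of_nat N2)%Z -> t2 j = 0%Z) ->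
  sumZ_sym N1 (fun j => IZR (t1 j) * powerRZ alpha j) =
  sumZ_sym N2 (fun j => IZR (t2 j) * powerRZ alpha j) ->
  Cexpi (- (2 * PI * sumZ_sym N1 (fun j => IZR (t1 j) * g j))) =
  Cexpi (- (2 * PI * sumZ_sym N2 (fun j => IZR (t2 j) * g j))).
Proof.
  intros Hd HPV HG H1 H2 Heq.
  (* Both sums are padded with zeros to the range [N1 + N2]. The identity serves twice: for powers
     of [alpha] in the hypothesis and for [g] in the conclusion. *)
  assert (Hdiff : forall x : Z -> R,
    sumZ_sym (N1 + N2) (fun j => IZR (t1 j - t2 j) * x j) =
    sumZ_sym N1 (fun j => IZR (t1 j) * x j) - sumZ_sym N2 (fun j => IZR (t2 j) * x j)).
  { intros x.
    rewrite <- (sumZ_sym_extend N1 (fun j => IZR (t1 j) * x j) N2)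
      by (intros j Hj; rewrite H1 by auto; ring).
    rewrite <- (sumZ_sym_extend N2 (fun j => IZR (t2 j) * x j) N1)
      by (intros j Hj; rewrite H2 by auto; ring).
    rewrite (Nat.add_comm N2 N1), !sumZ_sym_Rsum, <- Rsum_n_sub.
    apply Rsum_n_ext. intros i _. rewrite minus_IZR. ring. }
  destruct (laurent_relation_is_int alpha d conjs g (fun j => (t1 j - t2 j)%Z) (N1 + N2)
    Hd HPV HG) as [n Hn].
  { rewrite Hdiff. lra. }
  rewrite Hdiff in Hn.
  match goal with |- Cexpi (- (2 * PI * ?u)) = Cexpi (- (2 * PI * ?v)) =>
    replace (- (2 * PI * v)) with (- (2 * PI * u) + 2 * PI * IZR n) by (rewrite <- Hn; ring)
  end.
  rewrite Cexpi_add, Cexpi_2PI_Z. ring.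
Qed.

(** * Scaling of series and assembly *)

Lemma Cmul_Cscale r z w : Cmul (Cscale r z) w = Cscale r (Cmul z w).
Proof. apply Cx_ext; simpl; ring. Qed.

Lemma Cmod_Cscale r z : Cmod (Cscale r z) = Rabs r * Cmod z.
Proof.
  replace (Cscale r z) with (Cmul (RtoC r) z) by (apply Cx_ext; simpl; ring).
  now rewrite Cmod_mul, Cmod_RtoC.
Qed.

Lemma infinite_sum_scal r u l : infinite_sum u l -> infinite_sum (fun k => r * u k) (r * l).
Proof.
  intros H. apply is_series_Reals. apply is_series_Reals in H. exact (is_series_scal r u l H).
Qed.

Lemma Cseries_to_Cscale r f l : Cseries_to f l ->
  Cseries_to (fun k => Cscale r (f k)) (Cscale r l).
Proof. intros [H1 H2]. split; simpl; now apply infinite_sum_scal. Qed.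

Lemma Cseries_to_ext f g l : (forall k, f k = g k) -> Cseries_to f l -> Cseries_to g l.
Proof.
  intros E [H1 H2].
  split; [apply is_series_Reals; apply is_series_Reals in H1; revert H1
         |apply is_series_Reals; apply is_series_Reals in H2; revert H2];
  apply is_series_ext; intros k; now rewrite E.
Qed.

Lemma trig_series_of_Cseries b om l y : Cseries_to (fun k => Cmul (b k) (Cexpi (om k * y))) l ->
  Cre l = trig_series (fun k => Cre (b k)) (fun k => - Cim (b k)) om 0 y /\
  Cim l = trig_series (fun k => Cim (b k)) (fun k => Cre (b k)) om 0 y.
Proof.
  intros [H1 H2]. apply is_series_Reals in H1. apply is_series_Reals in H2.
  split; symmetry; apply is_series_unique.
  - revert H1. apply is_series_ext. intros k. unfold trig_term. simpl. ring.
  - revert H2. apply is_series_ext. intros k. unfold trig_term. simpl. ring.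
Qed.

Theorem theorem3p1
  (alpha : R) (d : nat) (conjs : nat -> Cx)
  (Hd : (2 <= d)%nat)
  (HPV : PV_with_conjugates alpha d conjs)
  (a : nat -> Cx)
  (tk : nat -> Z -> Z) (Nk : nat -> nat)
  (Htk_supp : forall k j, (Z.abs j > Z.of_nat (Nk k))%Z -> tk k j = 0%Z)
  (tau : nat -> R)
  (Htau : forall k, tau k = sumZ_sym (Nk k) (fun j => IZR (tk k j) * powerRZ alpha j))
  (Hdecay : exists eta : R, eta > 0 /\
     exists l : R, infinite_sum (fun k => Cmod (a k) * exp (eta * Rabs (tau k))) l)
  (ahat : R -> Cx)
  (Hahat : forall y : R, exists l : Cx,
     Cseries_to (fun k => Cmul (a k) (Cexpi (- (2 * PI * tau k * y)))) l /\
     ahat y = Cscale (/ Rabs alpha) l)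
  (HA : exists g : Z -> R, in_G d conjs g /\
     exists l : Cx,
       Cseries_to (fun k => Cmul (a k)
          (Cexpi (- (2 * PI * sumZ_sym (Nk k) (fun j => IZR (tk k j) * g j))))) l /\
       Cscale (/ Rabs alpha) l <> C0) :
  upper_density_finite ahat.
Proof.
  destruct Hdecay as [eta [Heta [S0 HS0]]]. destruct HA as [g [HG [l [Hl Hl0]]]].
  set (r := / Rabs alpha) in *. set (b := fun k => Cscale r (a k)).
  set (om := fun k => - (2 * PI * tau k)).
  set (chi := fun k => Cexpi (- (2 * PI * sumZ_sym (Nk k) (fun j => IZR (tk k j) * g j)))).
  (* The frequencies are -2 pi tau(k), so with this [rho] the weight exp(rho |om k|) is the one in
     the decay hypothesis. *)
  pose proof PI_RGT_0 as HPI. set (rho := eta / (2 * PI)).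
  assert (Hrho : 0 < rho) by (apply Rdiv_lt_0_compat; lra).
  assert (Hrw : forall k, rho * Rabs (om k) = eta * Rabs (tau k)).
  { intros k. unfold om, rho. rewrite Rabs_Ropp, !Rabs_mult, (Rabs_right 2), (Rabs_right PI) by lra.
    field. lra. }
  assert (Hexp : ex_series (fun k => Cmod (b k) * exp (rho * Rabs (om k)))).
  { apply is_series_Reals in HS0.
    apply (ex_series_ext (fun k => Rabs r * (Cmod (a k) * exp (eta * Rabs (tau k))))).
    - intros k. unfold b. rewrite Cmod_Cscale, Hrw. symmetry. apply Rmult_assoc.
    - apply ex_series_mult_l. now exists S0. }
  assert (Hex : ex_series (fun k => Cmod (b k))).
  { apply (ex_series_dominated _ (fun k => Cmod (b k) * exp (rho * Rabs (om k)))); auto.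
    intros k. rewrite Rabs_right by (apply Rle_ge, Cmod_ge_0).
    rewrite <- (Rmult_1_r (Cmod (b k))) at 1. apply Rmult_le_compat_l; [apply Cmod_ge_0|].
    eapply Rle_trans; [|apply exp_ineq1_le].
    assert (0 <= rho * Rabs (om k)) by (apply Rmult_le_pos; [lra|apply Rabs_pos]). lra. }
  assert (Hf : forall y, Cseries_to (fun k => Cmul (b k) (Cexpi (om k * y))) (ahat y)).
  { intros y. destruct (Hahat y) as [ly [Hly ->]].
    apply Cseries_to_Cscale with (r := r) in Hly. revert Hly. apply Cseries_to_ext.
    intros k. unfold b, om. rewrite Cmul_Cscale.
    now replace (- (2 * PI * tau k) * y) with (- (2 * PI * tau k * y)) by ring. }
  destruct (almost_periodic_lower_bound b chi om (Cscale r l) ahat Hex) as [c [T [Hc Hlow]]]; auto.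
  - intros k. apply Cmod_Cexpi.
  - intros j k E. apply (character_depends_on_value alpha d conjs); auto.
    rewrite <- !Htau. unfold om in E. apply (Rmult_eq_reg_l (2 * PI)); lra.
  - apply Cseries_to_Cscale with (r := r) in Hl. revert Hl. apply Cseries_to_ext.
    intros k. unfold b, chi. now rewrite Cmul_Cscale.
  (* The real part of b e^(iwy) is Re b cos(wy) - Im b sin(wy), the imaginary part Im b cos(wy) + Re
     b sin(wy); all these coefficients are at most |b| in absolute value. *)
  - destruct (trig_series_smooth (fun k => Cre (b k)) (fun k => - Cim (b k)) om
      (fun k => Cmod (b k)) rho Hrho) as [HD1 HB1]; auto.
    { intros k. apply Rabs_Cre_le. }
    { intros k. rewrite Rabs_Ropp. apply Rabs_Cim_le. }
    destruct (trig_series_smooth (fun k => Cim (b k)) (fun k => Cre (b k)) om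
      (fun k => Cmod (b k)) rho Hrho) as [HD2 HB2]; auto.
    { intros k. apply Rabs_Cim_le. }
    { intros k. apply Rabs_Cre_le. }
    assert (HM : 0 <= 2 * Series (fun k => Cmod (b k) * exp (rho * Rabs (om k)))).
    { pose proof (Rle_trans _ _ _ (Rabs_pos _) (HB1 0%nat 0)) as H. simpl in H. lra. }
    apply (upper_density_finite_of_lower_bound ahat _ rho c T _ _ HM Hrho Hc HD1 HB1 HD2 HB2);
      auto; intros y; apply (trig_series_of_Cseries b om (ahat y) y (Hf y)).
Qed.
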